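(* Let $K$ be a field of characteristic zero with algebraic closure $\overline K$. Let a $\overline K$-algebra $\Gamma$ be a division ring that satisfies the commutative centralizer condition, and let $A$ be a noncommutative $K$-algebra of Gelfand-Kirillov dimension $<3$ over $K$ such that $\overline A=\overline K\otimes_K A$ is (isomorphic to) a $\overline K$-subalgebra of $\Gamma$. Then $A$ admits the Dixmier partition and satisfies both the homogeneous centralizer condition and the commutative centralizer condition.
   Context: Algebras are associative and unital. For a $K$-algebra $A$ with centre $Z(A)$, put $\overline A=\overline K\otimes_K A$ and identify $A$ with $1\otimes A$. For $a\in A$ let $\operatorname{ad} a: b\mapsto [a,b]=ab-ba$, and put $C(a)=\ker(\operatorname{ad} a)$ (the centralizer of $a$ in $A$); $N(a)=\bigcup_{i\ge0}\ker\big((\operatorname{ad} a)^{i+1}\big)\subseteq A$; $D(a)=A\cap\bigoplus_{\lambda\in\overline K}\{b\in\overline A:[a,b]=\lambda b\}$; $F(a)=\{b\in A:\dim_K K[\operatorname{ad} a]\,b<\infty\}$. Types of elements $a\in A\setminus Z(A)$: $a\in\Delta_1(A)$ (strongly nilpotent) if $N(a)=A$ and $D(a)=C(a)$; $a\in\Delta_2(A)$ (weakly nilpotent) if $C(a)\ne N(a)\ne A$ and $D(a)=C(a)$; $a\in\Delta_3(A)$ (strongly semi-simple) if $N(a)=C(a)$ and $D(a)=A$; $a\in\Delta_4(A)$ (weakly semi-simple) if $N(a)=C(a)$ and $C(a)\ne D(a)=F(a)\ne A$; $a\in\Delta_5(A)$ (generic) if $N(a)=D(a)=C(a)$. $A$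 admits the Dixmier partition if $A\setminus Z(A)=\Delta_1(A)\cup\Delta_2(A)\cup\Delta_3(A)\cup\Delta_4(A)\cup\Delta_5(A)$. A noncommutative algebra satisfies the commutative centralizer condition if the centralizer of each of its non-central elements is a commutative algebra. A noncommutative algebra $A$ that admits the Dixmier partition satisfies the homogeneous centralizer condition if, for each $a\in A\setminus Z(A)$, the elements of $C(a)\setminus Z(A)$ are of exactly one of the following kinds: (1) all strongly nilpotent; (2) all weakly nilpotent; (3) all generic except for a subset $K^*a'+Z(A)$ of strongly semi-simple elements, for some $a'\in\Delta_3(A)$; (4) all generic except for a subset $K^*a'+Z(A)$ of weakly semi-simple elements, for some $a'\in\Delta_4(A)$; (5) all generic. Here $K^*=K\setminus\{0\}$. *)

(* Defs.v *)
From HB Require Import structures.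
From mathcomp Require Import all_boot all_order all_algebra.
From mathcomp Require Import all_classical all_reals all_analysis.

Set Implicit Arguments.
Unset Strict Implicit.
Unset Printing Implicit Defensive.

Import Order.TTheory GRing.Theory Num.Theory.

Local Open Scope classical_set_scope.
Local Open Scope ring_scope.
Local Open Scope quotient_scope.

(** * Extension of scalars

    [tensor iota A] is [L \otimes_K A] for a field morphism [iota : K -> L] and
    a [K]-algebra [A].  Its elements are the formal sums [\sum_i x_i \otimes a_i]
    (lists of pairs), two formal sums being identified when every [K]-bilinear
    map out of [L * A] takes the same value on them; this is the universal
    property, see [tensor_lift_pure], [tensor_pure_bilinear], [tensor_sum_pure]
    and [tensorP]. *)

Definition bilinear_map (K L : fieldType) (iota : {rmorphism K -> L})
    (A : algType K) (M : lmodType K) (f : L -> A -> M) : Prop :=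
  [/\ forall a, {morph f^~ a : x y / x + y},
      forall x, {morph f x : a b / a + b},
      forall k x a, f (iota k * x) a = k *: f x a &
      forall k x a, f x (k *: a) = k *: f x a].

Definition formal_eval (K L : fieldType) (A : algType K) (M : lmodType K)
    (f : L -> A -> M) (s : seq (L * A)) : M := \sum_(p <- s) f p.1 p.2.

Definition formal_eq (K L : fieldType) (iota : {rmorphism K -> L})
    (A : algType K) (s t : seq (L * A)) : Prop :=
  forall (M : lmodType K) (f : L -> A -> M),
    bilinear_map iota f -> formal_eval f s = formal_eval f t.

Section Tensor.
Variables (K L : fieldType) (iota : {rmorphism K -> L}) (A : algType K).
Implicit Types (s t : seq (L * A)) (M : lmodType K).

Definition formal_eqb s t : bool := `[< formal_eq iota s t >].

Lemma formal_eqb_refl : reflexive formal_eqb.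
Proof. by move=> s; apply/asboolP. Qed.

Lemma formal_eqb_sym : symmetric formal_eqb.
Proof.
by move=> s t; apply/asboolP/asboolP => e M f fb; apply/esym/e.
Qed.

Lemma formal_eqb_trans : transitive formal_eqb.
Proof.
move=> t s u /asboolP est /asboolP etu; apply/asboolP => M f fb.
by rewrite (est _ _ fb); apply: etu.
Qed.

Canonical formal_equiv :=
  EquivRel formal_eqb formal_eqb_refl formal_eqb_sym formal_eqb_trans.

Definition tensor := {eq_quot formal_equiv}.
HB.instance Definition _ := Choice.on tensor.
HB.instance Definition _ := EqQuotient.on tensor.

Implicit Types u v w : tensor.

Definition pure (x : L) (a : A) : tensor := \pi_tensor [:: (x, a)].

Definition tensor_lift M (f : L -> A -> M) u : M := formal_eval f (repr u).

Lemma tensor_lift_pi M (f : L -> A -> M) s :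
  bilinear_map iota f -> tensor_lift f (\pi_tensor s) = formal_eval f s.
Proof.
by move=> fb; have /eqmodP/asboolP := reprK (\pi_tensor s); apply.
Qed.

Lemma tensor_lift_pure M (f : L -> A -> M) x a :
  bilinear_map iota f -> tensor_lift f (pure x a) = f x a.
Proof. by move=> fb; rewrite tensor_lift_pi // /formal_eval big_seq1. Qed.

Lemma tensorP u v :
  (forall M (f : L -> A -> M),
     bilinear_map iota f -> tensor_lift f u = tensor_lift f v) -> u = v.
Proof.
move=> e; rewrite -[u]reprK -[v]reprK.
by apply/eqmodP/asboolP => M f fb; apply: e.
Qed.

Definition tensor_zero : tensor := \pi_tensor [::].
Definition tensor_opp u : tensor :=
  \pi_tensor [seq (- p.1, p.2) | p <- repr u].
Definition tensor_add u v : tensor := \pi_tensor (repr u ++ repr v).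
Definition tensor_mul u v : tensor :=
  \pi_tensor [seq (p.1 * q.1, p.2 * q.2) | p <- repr u, q <- repr v].
Definition tensor_scale (x : L) u : tensor :=
  \pi_tensor [seq (x * p.1, p.2) | p <- repr u].

Section Lift.
Variables (M : lmodType K) (f : L -> A -> M).
Hypothesis fb : bilinear_map iota f.

Let fDl a : {morph f^~ a : x y / x + y}. Proof. by case: fb. Qed.
Let fDr x : {morph f x : a b / a + b}. Proof. by case: fb. Qed.
Let fZl k x a : f (iota k * x) a = k *: f x a. Proof. by case: fb. Qed.
Let fZr k x a : f x (k *: a) = k *: f x a. Proof. by case: fb. Qed.

Lemma lift_zero : tensor_lift f tensor_zero = 0.
Proof. by rewrite tensor_lift_pi // /formal_eval big_nil. Qed.

Lemma lift_opp u : tensor_lift f (tensor_opp u) = - tensor_lift f u.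
Proof.
rewrite tensor_lift_pi // /tensor_lift /formal_eval big_map /= -sumrN.
apply: eq_bigr => -[x a] _ /=.
by rewrite -mulN1r -(rmorphN1 iota) fZl scaleN1r.
Qed.

Lemma lift_add u v :
  tensor_lift f (tensor_add u v) = tensor_lift f u + tensor_lift f v.
Proof. by rewrite tensor_lift_pi // /tensor_lift /formal_eval big_cat. Qed.

Lemma bilinear_scale x : bilinear_map iota (fun y a => f (x * y) a).
Proof.
split => [a y z|y a b|k y a|k y a] /=.
- by rewrite mulrDr fDl.
- by rewrite fDr.
- by rewrite mulrCA fZl.
- by rewrite fZr.
Qed.

Lemma lift_scale x u :
  tensor_lift f (tensor_scale x u) = tensor_lift (fun y a => f (x * y) a) u.
Proof. by rewrite tensor_lift_pi // /formal_eval big_map. Qed.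

Lemma bilinear_mulr x a : bilinear_map iota (fun y b => f (x * y) (a * b)).
Proof.
split => [b y z|y b c|k y b|k y b] /=.
- by rewrite mulrDr fDl.
- by rewrite mulrDr fDr.
- by rewrite mulrCA fZl.
- by rewrite -scalerAr fZr.
Qed.

Lemma bilinear_mul v : bilinear_map iota
  (fun x a => tensor_lift (fun y b => f (x * y) (a * b)) v).
Proof.
rewrite /tensor_lift /formal_eval.
split => [a x y|x a b|k x a|k x a] /=.
- by rewrite -big_split; apply: eq_bigr => p _; rewrite mulrDl fDl.
- by rewrite -big_split; apply: eq_bigr => p _; rewrite mulrDl fDr.
- by rewrite scaler_sumr; apply: eq_bigr => p _; rewrite -mulrA fZl.
- by rewrite scaler_sumr; apply: eq_bigr => p _; rewrite -scalerAl fZr.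
Qed.

Lemma lift_mul u v : tensor_lift f (tensor_mul u v) =
  tensor_lift (fun x a => tensor_lift (fun y b => f (x * y) (a * b)) v) u.
Proof.
by rewrite tensor_lift_pi // /tensor_lift /formal_eval big_allpairs_dep.
Qed.

End Lift.

Let lift := (lift_zero, lift_opp, lift_add, lift_scale, lift_mul).

Lemma eq_lift M (f g : L -> A -> M) u :
  (forall x a, f x a = g x a) -> tensor_lift f u = tensor_lift g u.
Proof. by move=> e; apply: eq_bigr => p _; apply: e. Qed.

Lemma lift_addf M (f g : L -> A -> M) u :
  tensor_lift (fun x a => f x a + g x a) u = tensor_lift f u + tensor_lift g u.
Proof. by rewrite /tensor_lift /formal_eval big_split. Qed.

Fact tensor_addA : associative tensor_add.
Proof. by move=> u v w; apply: tensorP => M f fb; rewrite !lift // addrA. Qed.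

Fact tensor_addC : commutative tensor_add.
Proof. by move=> u v; apply: tensorP => M f fb; rewrite !lift // addrC. Qed.

Fact tensor_add0 : left_id tensor_zero tensor_add.
Proof. by move=> u; apply: tensorP => M f fb; rewrite !lift // add0r. Qed.

Fact tensor_addN : left_inverse tensor_zero tensor_opp tensor_add.
Proof. by move=> u; apply: tensorP => M f fb; rewrite !lift // addNr. Qed.

HB.instance Definition _ := GRing.isZmodule.Build tensor
  tensor_addA tensor_addC tensor_add0 tensor_addN.

Fact tensor_mulA : associative tensor_mul.
Proof.
move=> u v w; apply: tensorP => M f fb; rewrite !lift_mul //; last first.
  exact: bilinear_mul.
apply: eq_lift => x a; rewrite lift_mul; last exact: bilinear_mulr.
by apply: eq_lift => y b; apply: eq_lift => z c; rewrite !mulrA.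
Qed.

Fact tensor_mul1 : left_id (pure 1 1) tensor_mul.
Proof.
move=> u; apply: tensorP => M f fb; rewrite lift_mul // tensor_lift_pure.
  by apply: eq_lift => x a; rewrite !mul1r.
exact: bilinear_mul.
Qed.

Fact tensor_mulr1 : right_id (pure 1 1) tensor_mul.
Proof.
move=> u; apply: tensorP => M f fb; rewrite lift_mul //.
apply: eq_lift => x a; rewrite tensor_lift_pure ?mulr1 //.
exact: bilinear_mulr.
Qed.

Fact tensor_mulDl : left_distributive tensor_mul +%R.
Proof.
move=> u v w; apply: tensorP => M f fb.
rewrite lift_add // !lift_mul // lift_add //; exact: bilinear_mul.
Qed.

Fact tensor_mulDr : right_distributive tensor_mul +%R.
Proof.
move=> u v w; apply: tensorP => M f fb; rewrite lift_add // !lift_mul //.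
rewrite -lift_addf; apply: eq_lift => x a; rewrite lift_add //.
exact: bilinear_mulr.
Qed.

(* The algebra structures of the library exclude the zero ring, so [1 \otimes 1]
   has to be shown nonzero: it is detected by a linear form on [A]. *)
Lemma linear_form_one : exists g : A -> K,
  [/\ {morph g : a b / a + b}, forall k a, g (k *: a) = k * g a & g 1 = 1].
Proof.
pose P (W : set A) :=
  (forall k a b, W a -> W b -> W (k *: a + b)) /\ ~ W 1.
have [F FP Ftot|W [[WD W1] Wmax]] := @Zorn_bigcup A P.
  split => // [k a b [X FX Xa] [Y FY Yb]|[X FX X1]].
    case: (Ftot X Y FX FY) => sXY; [exists Y|exists X] => //.
      by have [YD _] := FP _ FY; apply: YD => //; apply: sXY.
    by have [XD _] := FP _ FX; apply: XD => //; apply: sXY.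
  by have [_ []] := FP _ FX.
have W0 : W 0.
  apply: contrapT => nW0; have /Wmax : W `<` [set 0] `|` W.
    by split; [right|move=> /(_ 0 (or_introl erefl))].
  apply; split => // [k a b [->|Wa] [->|Wb]|[/eqP|//]].
  - by left; rewrite scaler0 addr0.
  - by rewrite scaler0 add0r; right.
  - rewrite addr0; have := WD (k - 1) a a Wa Wa.
    by rewrite scalerBl scale1r subrK; right.
  - by right; apply: WD.
  - by rewrite oner_eq0.
have WDc a b : W a -> W b -> W (a + b).
  by move=> Wa Wb; rewrite -[a]scale1r; apply: WD.
have WZ k a : W a -> W (k *: a) by move=> Wa; rewrite -[_ *: _]addr0; apply: WD.
have ex a : {k : K | W (a - k *: 1)}.
  apply: cid; apply: contrapT => nk.
  have nWa : ~ W a by move=> Wa; apply: nk; exists 0; rewrite scale0r subr0.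
  pose V := [set b | exists k, W (b - k *: a)].
  have : W `<` V.
    split => [b Wb|sVW]; first by exists 0; rewrite scale0r subr0.
    by apply: nWa; apply: sVW; exists 1; rewrite scale1r subrr.
  move=> /Wmax; apply; split => // [k b c [l Wl] [m Wm]|[k Wk]].
    exists (k * l + m).
    suff -> : k *: b + c - (k * l + m) *: a =
              k *: (b - l *: a) + (c - m *: a) by apply: WD.
    by rewrite scalerDl scalerBr scalerA opprD addrACA.
  have k0 : k != 0.
    by apply/eqP => k0; apply: W1; move: Wk; rewrite k0 scale0r subr0.
  apply: nk; exists k^-1; have := WZ (- k^-1) _ Wk.
  by rewrite scaleNr scalerBr scalerA mulVf // scale1r opprB.
have uniq a k l : W (a - k *: 1) -> W (a - l *: 1) -> k = l.
  move=> Wk Wl; apply: contrapT => /eqP kl; apply: W1.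
  have : W ((l - k) *: 1).
    have := WD (-1) _ _ Wl Wk; rewrite scaleN1r opprB addrA.
    by rewrite subrK scalerBl.
  move=> /(WZ (l - k)^-1); rewrite scalerA mulVf ?scale1r //.
  by rewrite subr_eq0 eq_sym.
exists (fun a => sval (ex a)); split => [a b|k a|].
- apply: uniq (svalP (ex (a + b))) _.
  have := WDc _ _ (svalP (ex a)) (svalP (ex b)).
  by rewrite scalerDl opprD addrACA.
- apply: uniq (svalP (ex (k *: a))) _.
  by rewrite -scalerA -scalerBr; apply: WZ; exact: (svalP (ex a)).
- by apply: uniq (svalP (ex 1)) _; rewrite scale1r subrr.
Qed.

Fact tensor_oner_neq0 : pure 1 1 != tensor_zero.
Proof.
have [g [gD gZ g1]] := linear_form_one.
pose scale (k : K) (x : L) := iota k * x.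
have scaleA k l x : scale k (scale l x) = scale (k * l) x.
  by rewrite /scale rmorphM mulrA.
have scale1 : left_id 1 scale by move=> x; rewrite /scale rmorph1 mul1r.
have scaleDr : right_distributive scale +%R by move=> k x y; apply: mulrDr.
have scaleDl x : {morph scale^~ x : k l / k + l}.
  by move=> k l; rewrite /scale rmorphD mulrDl.
pose m := GRing.Zmodule_isLmodule.Build K L scaleA scale1 scaleDr scaleDl.
pose M : lmodType K := HB.pack L m.
pose f (x : L) (a : A) : M := iota (g a) * x.
have fb : bilinear_map iota f.
  split => [a x y|x a b|k x a|k x a]; rewrite /f.
  - exact: mulrDr.
  - by rewrite gD rmorphD mulrDl.
  - by rewrite mulrCA.
  - by rewrite gZ rmorphM -mulrA.
apply/eqP => /(congr1 (tensor_lift f)).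
rewrite lift_zero // tensor_lift_pure // /f g1 rmorph1 mulr1.
by move/eqP; rewrite (oner_eq0 L).
Qed.

HB.instance Definition _ := GRing.Zmodule_isNzRing.Build tensor
  tensor_mulA tensor_mul1 tensor_mulr1 tensor_mulDl tensor_mulDr
  tensor_oner_neq0.

Fact tensor_scaleA x y u :
  tensor_scale x (tensor_scale y u) = tensor_scale (x * y) u.
Proof.
apply: tensorP => M f fb; rewrite !lift_scale //; last exact: bilinear_scale.
by apply: eq_lift => z a; rewrite mulrA.
Qed.

Fact tensor_scale1 : left_id 1 tensor_scale.
Proof.
move=> u; apply: tensorP => M f fb; rewrite lift_scale //.
by apply: eq_lift => x a; rewrite mul1r.
Qed.

Fact tensor_scaleDr : right_distributive tensor_scale +%R.
Proof.
move=> x u v; apply: tensorP => M f fb.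
rewrite lift_add // !lift_scale // lift_add //; exact: bilinear_scale.
Qed.

Fact tensor_scaleDl u : {morph tensor_scale^~ u : x y / x + y}.
Proof.
move=> x y; apply: tensorP => M f fb.
rewrite lift_add // !lift_scale // -lift_addf; apply: eq_lift => z a.
by case: fb => fDl _ _ _; rewrite mulrDl fDl.
Qed.

HB.instance Definition _ := GRing.Zmodule_isLmodule.Build L tensor
  tensor_scaleA tensor_scale1 tensor_scaleDr tensor_scaleDl.

Fact tensor_scaleAl (x : L) u v : x *: (u * v) = (x *: u) * v.
Proof.
apply: tensorP => M f fb.
rewrite lift_scale // !lift_mul //; last exact: bilinear_scale.
rewrite lift_scale; last exact: bilinear_mul.
by apply: eq_lift => y a; apply: eq_lift => z b; rewrite mulrA.
Qed.

HB.instance Definition _ := GRing.Lmodule_isLalgebra.Build L tensor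
  tensor_scaleAl.

Fact tensor_scaleAr (x : L) u v : x *: (u * v) = u * (x *: v).
Proof.
apply: tensorP => M f fb.
rewrite lift_scale // !lift_mul //; last exact: bilinear_scale.
apply: eq_lift => y a; rewrite lift_scale; last exact: bilinear_mulr.
by apply: eq_lift => z b; rewrite mulrCA.
Qed.

HB.instance Definition _ := GRing.Lalgebra_isAlgebra.Build L tensor
  tensor_scaleAr.

Lemma pureM x y a b : pure x a * pure y b = pure (x * y) (a * b).
Proof.
apply: tensorP => M f fb.
rewrite lift_mul // !tensor_lift_pure //; first exact: bilinear_mulr.
exact: bilinear_mul.
Qed.

Lemma pureZ x y a : x *: pure y a = pure (x * y) a.
Proof.
apply: tensorP => M f fb; rewrite lift_scale // !tensor_lift_pure //.
exact: bilinear_scale.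
Qed.

Lemma pure11 : pure 1 1 = 1. Proof. by []. Qed.

Lemma tensor_pure_bilinear :
  [/\ forall a, {morph pure^~ a : x y / x + y},
      forall x, {morph pure x : a b / a + b} &
      forall k x a, pure x (k *: a) = pure (iota k * x) a].
Proof.
split => [a x y|x a b|k x a]; apply: tensorP => M f fb;
  rewrite ?lift_add // !tensor_lift_pure //; case: fb => fDl fDr fZl fZr.
- by rewrite fDl.
- by rewrite fDr.
- by rewrite fZl fZr.
Qed.

Lemma tensor_liftD M (f : L -> A -> M) :
  bilinear_map iota f -> {morph tensor_lift f : u v / u + v}.
Proof. by move=> fb u v; apply: lift_add. Qed.

Lemma tensor_sum_pure u : u = \sum_(p <- repr u) pure p.1 p.2.
Proof.
apply: tensorP => M f fb; rewrite {1}/tensor_lift /formal_eval.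
rewrite (big_morph (tensor_lift f) (tensor_liftD fb) (lift_zero fb)).
by apply: eq_bigr => p _; rewrite tensor_lift_pure.
Qed.

End Tensor.

Arguments pure {K L} iota {A} x a.

(** * Dimensions *)

Section Dimension.
Variables (K : fieldType) (V : lmodType K).
Implicit Types S : set V.

Definition lin_comb n (t : 'I_n -> V) (c : 'I_n -> K) : V :=
  \sum_(i < n) c i *: t i.

Definition is_basis n (t : 'I_n -> V) S : Prop :=
  (forall c, lin_comb t c = 0 -> forall i, c i = 0) /\ S = range (lin_comb t).

Definition has_dim S (n : nat) : Prop :=
  exists t : 'I_n -> V, is_basis t S.

Definition finite_dim S : Prop := exists n, has_dim S n.

(* Meaningful for finite-dimensional subspaces only, see [dimE]; the value is
   the irrelevant default [0] otherwise. *)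
Definition dim S : nat := xget 0%N [set n | has_dim S n].

Definition lin_span S : set V :=
  [set v | exists2 s : seq (K * V),
     (forall p, p \in s -> S p.2) & v = \sum_(p <- s) p.1 *: p.2].

Lemma has_dim_le S m n : has_dim S m -> has_dim S n -> (m <= n)%N.
Proof.
move=> [t [tfree St]] [u [_ Su]].
have /choice[c cE] (i : 'I_m) : exists c : 'I_n -> K, lin_comb u c = t i.
  have : S (t i).
    rewrite St; exists (fun j => (j == i)%:R) => //.
    rewrite /lin_comb (bigD1 i) //= eqxx scale1r big1 ?addr0 // => j /negbTE ->.
    by rewrite scale0r.
  by rewrite Su => -[c _ <-]; exists c.
pose M := \matrix_(i < m, j < n) c i j.
suff : row_free M by move=> /eqP <-; apply: rank_leq_col.
rewrite -kermx_eq0; apply/eqP/row_matrixP => k; rewrite row0.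
have : row k (kermx M) *m M = 0 by rewrite -row_mul mulmx_ker row0.
move: (row k _) => x xM; apply/rowP => i; rewrite mxE.
apply: (tfree (x 0)); rewrite /lin_comb.
under eq_bigr do rewrite -cE /lin_comb scaler_sumr.
rewrite exchange_big big1 // => j _ /=.
under eq_bigr do rewrite scalerA.
rewrite -scaler_suml; move/rowP/(_ j): xM; rewrite !mxE.
by under eq_bigr do rewrite mxE; move=> ->; rewrite scale0r.
Qed.

Lemma dimE S n : has_dim S n -> dim S = n.
Proof.
move=> Sn; rewrite /dim; case: xgetP => [m _ Sm|/(_ n)//].
by apply/eqP; rewrite eqn_leq !(@has_dim_le S).
Qed.

End Dimension.

(* The space [K + V + ... + V^n]; the empty word contributes [K]. *)
Definition power_space (K : fieldType) (A : algType K) (V : set A) (n : nat) :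
    set A :=
  lin_span [set \prod_(x <- w) x | w in
    [set w : seq A | (size w <= n)%N /\ forall x, x \in w -> V x]].

Definition GKdim (R : realType) (K : fieldType) (A : algType K) : \bar R :=
  ereal_sup [set limn_esup
      (fun n => (ln (dim (power_space V n))%:R / ln n%:R)%:E) |
    V in [set V : set A | finite_dim V]].

(** * Centralizers and the Dixmier partition *)

Definition noncommutative (B : nzRingType) : Prop :=
  exists x y : B, x * y <> y * x.

Definition division_ring (B : unitRingType) : Prop :=
  forall x : B, x != 0 -> x \is a GRing.unit.

Definition centre (B : nzRingType) : set B := [set z | forall x, z * x = x * z].

Definition ad (B : nzRingType) (a b : B) : B := a * b - b * a.

Definition centralizer (B : nzRingType) (a : B) : set B := [set b | ad a b = 0].

Definition commutative_centralizer_condition (B : nzRingType) : Prop :=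
  noncommutative B /\
  forall a : B, ~ centre a ->
  forall b c : B, centralizer a b -> centralizer a c -> b * c = c * b.

Definition is_algebraic_closure (K : fieldType) (Kbar : closedFieldType)
    (iota : {rmorphism K -> Kbar}) : Prop :=
  forall x : Kbar, algebraicOver iota x.

Section Dixmier.
Variables (K : fieldType) (Kbar : closedFieldType).
Variables (iota : {rmorphism K -> Kbar}) (A : algType K).
Implicit Types a b : A.

(* [N(a)] *)
Definition ad_nilpotent a : set A :=
  \bigcup_(i in [set: nat]) [set b | iter i.+1 (ad a) b = 0].

(* [D(a)]: an element of the direct sum of the eigenspaces of [ad a] on
   [Kbar \otimes A] is a finite sum of eigenvectors [p.2] of eigenvalues [p.1];
   [A] is embedded in [Kbar \otimes A] by [pure iota 1]. *)
Definition ad_diagonal a : set A :=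
  [set b | exists2 s : seq (Kbar * tensor iota A),
     (forall p, p \in s -> ad (pure iota 1 a) p.2 = p.1 *: p.2) &
     pure iota 1 b = \sum_(p <- s) p.2].

(* [F(a)] *)
Definition ad_finite a : set A :=
  [set b | finite_dim
     [set \sum_(i < size p) p`_i *: iter i (ad a) b | p in [set: {poly K}]]].

Inductive dixmier_type :=
  | StronglyNilpotent
  | WeaklyNilpotent
  | StronglySemisimple
  | WeaklySemisimple
  | Generic.

Definition Delta (t : dixmier_type) : set A :=
  [set a | ~ centre a /\
   let C := centralizer a in let N := ad_nilpotent a in
   let D := ad_diagonal a in let F := ad_finite a in
   match t with
   | StronglyNilpotent => N = setT /\ D = C
   | WeaklyNilpotent => [/\ C <> N, N <> setT & D = C]
   | StronglySemisimple => N = C /\ D = setT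
   | WeaklySemisimple => [/\ N = C, C <> D, D = F & F <> setT]
   | Generic => N = D /\ D = C
   end].

Definition dixmier_partition : Prop :=
  ~` (@centre A) = \bigcup_(t in [set: dixmier_type]) Delta t.

(* [K^* a + Z(A)] *)
Definition punctured_line a : set A :=
  [set x | exists k z, [/\ k != 0, centre z & x = k *: a + z]].

Definition homogeneous_kind a (t : dixmier_type) : Prop :=
  let C := centralizer a `\` @centre A in
  match t with
  | StronglyNilpotent | WeaklyNilpotent | Generic => C `<=` Delta t
  | StronglySemisimple | WeaklySemisimple =>
      exists2 a', Delta t a' &
        [/\ punctured_line a' `<=` C,
            punctured_line a' `<=` Delta t &
            C `\` punctured_line a' `<=` Delta Generic]
  end.

Definition homogeneous_centralizer_condition : Prop :=
  [/\ noncommutative A, dixmier_partition &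
      forall a, ~ centre a -> exists! t, homogeneous_kind a t].

End Dixmier.

Arguments dixmier_partition {K Kbar} iota A.
Arguments homogeneous_centralizer_condition {K Kbar} iota A.

(* Main.v *)
Require Import Defs.
From HB Require Import structures.
From mathcomp Require Import all_boot all_order all_algebra.
From mathcomp Require Import all_classical all_reals all_analysis.

Set Implicit Arguments.
Unset Strict Implicit.
Unset Printing Implicit Defensive.

Import Order.TTheory GRing.Theory Num.Theory.

Local Open Scope ring_scope.

(** Write [T] for the extension of scalars of [A] and [G] for the division ring
    that contains it. Two facts are played against each other. On the one hand
    the centralizer in [G] of a noncentral element [a] is a commutative field
    [L], in which [a] is transcendental over the algebraically closed base
    field. On the other hand, if [y] and [z] in [T] are such that the monomials
    [y^i z^j] are left independent over [L], then the monomials [a^h y^i z^j]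
    are independent over the base field, the powers [V^n] of a suitable space
    [V] grow at least like [(n/3)^3], and the Gelfand-Kirillov dimension of [A]
    is at least 3 ([GKdim_ge3], [monomials_free]). Hence such [y] and [z] do not
    exist.

    Left independence always comes from the same argument
    ([left_free_twist]): right multiplication by [a] is linear for the left
    action of [L], and generalized eigenvectors with eigenvalues in [L] are
    independent as soon as no two of them have the same eigenvalue and the same
    height. It is applied twice.

    - If [[a,c] = lam c] and [[a,b] = lam b + c] with [lam] and [c] nonzero, then
      [b^i c^j] is a generalized eigenvector of height [i] and eigenvalue
      [a - (i + j) lam] ([jordan_left_free]). So [ad a] has no Jordan block for a
      nonzero eigenvalue. It does not have both an eigenvector [u] of nonzero
      eigenvalue and a [y] with [[a,y]] nonzero and [[a,[a,y]] = 0] either, as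
      [y u] and [[a,y] u] would form such a block. This gives the Dixmier
      partition: if [N(a)] is larger than [C(a)] then [D(a) = C(a)], and if
      [D(a)] is larger than [C(a)] then every polynomial relation for [ad a]
      splits into eigenvectors, so that [D(a) = F(a)].

    - Let [a] and [b] commute, and let [u] and [v] be eigenvectors of [ad a] and
      of [ad b] for nonzero eigenvalues. Conjugation by [u] and [v] preserves
      [L = C(a) = C(b)]. If the [u^i v^j] move [a] to distinct elements, they
      are independent eigenvectors, which is excluded. Otherwise a power of [u]
      translates both [a] and [b] by constants, so it commutes with some
      [b - kap a]; as [a] also commutes with that element but not with the power
      of [u], the element is central ([rigid_or_left_free]). A retraction of the
      algebraic closure onto [K] moves [kap] into [K]. So the semisimple
      elements of a centralizer form a single punctured line modulo the centre.

    Finally [N(a)] depends only on [C(a)] when [a] varies among commuting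
    noncentral elements ([ad_nilpotent_sub]), so the nilpotent types are constant
    on centralizers, and the homogeneous centralizer condition follows by
    inspection of the types. *)

(** * Finite-dimensional subspaces *)

Section Span.
Variables (k : fieldType) (V : lmodType k).
Implicit Types (S : set V) (s : seq V).

Definition linear_subspace S : Prop :=
  S 0 /\ forall c u v, S u -> S v -> S (c *: u + v).

Definition free_family n (t : 'I_n -> V) : Prop :=
  forall c, lin_comb t c = 0 -> forall i, c i = 0.

Lemma subspaceD S : linear_subspace S -> forall u v, S u -> S v -> S (u + v).
Proof. by case=> _ SD u v Su Sv; rewrite -[u]scale1r; apply: SD. Qed.

Lemma subspaceZ S : linear_subspace S -> forall c u, S u -> S (c *: u).
Proof. by case=> S0 SD c u Su; rewrite -[_ *: _]addr0; apply: SD. Qed.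

Lemma subspace_sum S (J : Type) (r : seq J) (P : pred J) (F : J -> V) :
  linear_subspace S -> (forall j, P j -> S (F j)) -> S (\sum_(j <- r | P j) F j).
Proof.
move=> sS SF; elim/big_rec: _ => [|j v]; first by case: sS.
by move=> Pj Sv; apply: (subspaceD sS) => //; apply: SF.
Qed.

Lemma lin_span_subspace S : linear_subspace (lin_span S).
Proof.
split=> [|c u v [s sS ->] [t tS ->]].
  by exists [::] => //; rewrite big_nil.
exists ([seq (c * p.1, p.2) | p <- s] ++ t) => [p|].
  by rewrite mem_cat => /orP[/mapP[q qs ->]|/tS//]; apply: (sS q).
rewrite big_cat big_map scaler_sumr; congr (_ + _).
by apply: eq_bigr => p _; rewrite scalerA.
Qed.

Lemma lin_span_gen S u : S u -> lin_span S u.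
Proof.
move=> Su; exists [:: (1, u)]; last by rewrite big_seq1 scale1r.
by move=> p; rewrite inE => /eqP ->.
Qed.

Lemma lin_span_sub S S' :
  linear_subspace S' -> (S `<=` S')%classic -> (lin_span S `<=` S')%classic.
Proof.
move=> sS' sub u [s sS ->]; rewrite big_seq_cond.
apply: subspace_sum => // p; rewrite andbT => /sS/sub.
exact: subspaceZ.
Qed.

(** The coordinate matrix of too long a family would have a nonzero row
    kernel. *)
Lemma free_family_le n (t : 'I_n -> V) m (u : 'I_m -> V) :
  free_family t -> (forall i, range (lin_comb u) (t i)) -> (n <= m)%N.
Proof.
move=> tfree tu; have /choice[c cE] : forall i, exists c, lin_comb u c = t i.
  by move=> i; have [c _ <-] := tu i; exists c.
pose M : 'M[k]_(n, m) := \matrix_i \row_j c i j.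
rewrite leqNgt; apply/negP => mn.
have /matrix0Pn[i [j]] : kermx M != 0.
  rewrite -mxrank_eq0 mxrank_ker subn_eq0 -ltnNge.
  exact: leq_ltn_trans (rank_leq_col _) mn.
case/negP; apply/eqP; apply: (tfree (kermx M i)).
have : row i (kermx M) *m M = 0 by rewrite -row_mul mulmx_ker row0.
move=> /rowP iM; rewrite /lin_comb.
under eq_bigr do rewrite -cE /lin_comb scaler_sumr.
rewrite exchange_big big1 // => l _ /=.
transitivity (\sum_j (kermx M i j * c j l) *: u l).
  by apply: eq_bigr => j' _; rewrite scalerA.
rewrite -scaler_suml; move: (iM l); rewrite !mxE => iMl.
rewrite [X in X *: _](_ : _ = 0) ?scale0r //; rewrite -[RHS]iMl.
by apply: eq_bigr => j' _; rewrite !mxE.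
Qed.

Lemma range_lin_comb_subspace n (t : 'I_n -> V) : linear_subspace (range (lin_comb t)).
Proof.
split=> [|c _ _ [f _ <-] [g _ <-]].
  by exists (fun=> 0) => //; rewrite /lin_comb big1 // => i _; rewrite scale0r.
exists (fun i => c * f i + g i) => //; rewrite /lin_comb scaler_sumr -big_split.
by apply: eq_bigr => i _; rewrite /= scalerA scalerDl.
Qed.

Lemma range_lin_comb_gen n (t : 'I_n -> V) i : range (lin_comb t) (t i).
Proof.
exists (fun j => (j == i)%:R) => //; rewrite /lin_comb (bigD1 i) //= eqxx.
by rewrite scale1r big1 ?addr0 // => j /negbTE ->; rewrite scale0r.
Qed.

Lemma lin_span_range s :
  (lin_span [set` s] `<=` range (lin_comb (fun i : 'I_(size s) => s`_i)))%classic.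
Proof.
apply: lin_span_sub; first exact: range_lin_comb_subspace.
move=> u us; have iu : (index u s < size s)%N by rewrite index_mem.
have := range_lin_comb_gen (fun i : 'I_(size s) => s`_i) (Ordinal iu).
by rewrite /= nth_index.
Qed.

(** A longest free family in a subspace spans it; the lengths are bounded by
    that of any finite family whose span contains the subspace. *)
Lemma subspace_finite_dim S s :
  linear_subspace S -> (S `<=` lin_span [set` s])%classic -> finite_dim S.
Proof.
move=> sS Ss; pose P n := `[< exists t : 'I_n -> V,
  free_family t /\ forall i, S (t i) >].
have P0 : exists n, P n.
  by exists 0%N; apply/asboolP; exists (fun=> 0); split=> [c _ []|[]].
have Pmax n : P n -> (n <= size s)%N.
  move=> /asboolP[t [tfree St]]; apply: free_family_le tfree _ => i.
  by apply/lin_span_range/Ss/St.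
have [n /asboolP[t [tfree St]] nmax] := ex_maxnP P0 Pmax.
exists n, t; split=> //; apply/seteqP; split=> [v Sv|_ [c _ <-]]; last first.
  by apply: subspace_sum => // i _; apply: subspaceZ.
apply: contrapT => nv; have /nmax : P n.+1; last by rewrite ltnn.
apply/asboolP; exists (fun i => if unlift ord_max i is Some j then t j else v).
split=> [c|i]; last by case: unliftP => [j _|].
rewrite /lin_comb big_ord_recr /= unlift_none => cE.
have {}cE : lin_comb t (fun i => c (lift ord_max i)) + c ord_max *: v = 0.
  rewrite -[RHS]cE; congr (_ + _); apply: eq_bigr => i _.
  have -> : widen_ord (leqnSn n) i = lift ord_max i.
    by apply/val_inj; rewrite /= /bump leqNgt ltn_ord.
  by rewrite liftK.
have c0 : c ord_max = 0.
  apply/eqP/negPn/negP => c0; apply: nv.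
  have -> : v = - (c ord_max)^-1 *: lin_comb t (fun i => c (lift ord_max i)).
    move/eqP: cE; rewrite addr_eq0 => /eqP ->.
    by rewrite scaleNr scalerN opprK scalerA mulVf // scale1r.
  apply: subspaceZ; first exact: range_lin_comb_subspace.
  by exists (fun i => c (lift ord_max i)).
move: cE; rewrite c0 scale0r addr0 => /tfree cE i.
by case: (unliftP ord_max i) => [j ->|->].
Qed.

End Span.

(** * Inner derivations *)

Lemma ad_eq0 (B : nzRingType) (a b : B) : ad a b = 0 <-> GRing.comm a b.
Proof. by split=> [/eqP|ab]; rewrite /ad ?subr_eq0 ?ab ?subrr // => /eqP. Qed.

Lemma comm_centre (B : nzRingType) (a z : B) : centre z -> GRing.comm a z.
Proof. by move=> zz; apply: esym. Qed.

Lemma comm_trans (B : nzRingType) (a b c : B) :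
  commutative_centralizer_condition B ->
  ~ centre a -> GRing.comm a b -> GRing.comm a c -> GRing.comm b c.
Proof. by case=> _ cc na ab ac; apply: cc na _ _ _ _; apply/ad_eq0. Qed.

Lemma adM (B : nzRingType) (a u v : B) : ad a (u * v) = ad a u * v + u * ad a v.
Proof. by rewrite /ad mulrBl mulrBr !mulrA addrA subrK. Qed.

Lemma adD (B : nzRingType) (a : B) : {morph ad a : b c / b + c}.
Proof. by move=> b c; rewrite /ad mulrDr mulrDl opprD addrACA. Qed.

Lemma adB (B : nzRingType) (a : B) : {morph ad a : b c / b - c}.
Proof.
move=> b c; rewrite /ad mulrBr mulrBl !opprB [LHS]addrACA [RHS]addrACA.
by congr (_ + _); apply: addrC.
Qed.

Lemma adBl (k : fieldType) (B : algType k) (a b v : B) c :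
  ad (b - c *: a) v = ad b v - c *: ad a v.
Proof.
rewrite /ad mulrBl mulrBr -scalerAl -scalerAr scalerBr !opprB.
by rewrite [LHS]addrACA [RHS]addrACA; congr (_ + _); apply: addrC.
Qed.

Lemma adZ (k : fieldType) (B : algType k) (a : B) c : {morph ad a : b / c *: b}.
Proof. by move=> b; rewrite /ad -scalerAr -scalerAl scalerBr. Qed.

Lemma ad0 (B : nzRingType) (a : B) : ad a 0 = 0.
Proof. by rewrite /ad mulr0 mul0r subrr. Qed.

Lemma ad_affine (k : fieldType) (B : algType k) (a z b : B) c :
  centre z -> ad (c *: a + z) b = c *: ad a b.
Proof.
move=> zz; rewrite /ad mulrDl mulrDr opprD addrACA zz subrr addr0.
by rewrite -scalerAl -scalerAr scalerBr.
Qed.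

(** * Growth *)

Section CubicGrowth.
Import numFieldNormedType.Exports.
Local Open Scope classical_set_scope.

(** The logarithm of [(n/3)^3] is [3 ln n - 3 ln 3], and the constant is
    negligible after division by [ln n]. *)
Lemma cubic_growth_limn_esup (R : realType) (d : nat -> nat) :
  (forall n, ((n %/ 3).+1 ^ 3 <= d n)%N) ->
  (3%:E <= limn_esup (fun n => (ln (d n)%:R / ln n%:R : R)%:E))%E.
Proof.
move=> dn; rewrite limn_esup_lim.
have lny : (fun n => ln (n%:R : R)) @ \oo --> +oo.
  apply/cvgryPge => M; have /cvgryPge/(_ (expR M)) := @cvgr_idn R.
  apply: filterS => n Mn; rewrite -[M]expRK ler_ln ?posrE ?expR_gt0 //.
  exact: lt_le_trans (expR_gt0 _) Mn.
pose v n : R := 3 - 3 * ln 3 * (ln n%:R)^-1.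
have v3 : v @ \oo --> (3 : R).
  rewrite -[X in _ --> X]subr0 -(mulr0 (3 * ln 3)).
  apply: cvgB; first exact: cvg_cst.
  apply: cvgM; first exact: cvg_cst.
  apply/gtr0_cvgV0 => //; near=> n; apply: ln_gt0.
  by rewrite ltr1n; near: n; exists 2%N.
have -> : 3%:E = limn (EFin \o v).
  by apply/esym/cvg_lim => //; apply: cvg_EFin v3; exact: nearW.
apply: lee_lim.
- by apply/cvg_ex; exists 3%:E; apply: cvg_EFin v3; exact: nearW.
- exact: is_cvg_esups.
near=> n; rewrite /=.
have n2 : (2 <= n)%N by near: n; exists 2%N.
have lnn : 0 < ln (n%:R : R) by apply: ln_gt0; rewrite ltr1n.
apply: (@le_trans _ _ (ln (d n)%:R / ln n%:R)%:E); last first.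
  by apply: ereal_sup_ubound; exists n => /=.
rewrite lee_fin ler_pdivlMr // /v mulrBl divfK ?gt_eqF //.
rewrite -mulrBr -ln_div ?posrE ?ltr0n //; last exact: leq_trans n2.
rewrite mulrC mulr_natr -lnXn; last first.
  by rewrite divr_gt0 // ltr0n (leq_trans _ n2).
have dpos : (0 < d n)%N by apply: leq_trans (dn n); rewrite expn_gt0.
rewrite ler_ln ?posrE ?ltr0n // ?exprn_gt0 ?divr_gt0 ?ltr0n ?(leq_trans _ n2) //.
apply: (@le_trans _ _ ((n %/ 3).+1 ^ 3)%:R); last by rewrite ler_nat.
rewrite natrX lerXn2r ?nnegrE ?divr_ge0 // ler_pdivrMr // -natrM ler_nat.
by rewrite ltnW // mulnC; have := ltn_ceil n (isT : 0 < 3)%N; rewrite mulnC.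
Unshelve. all: by end_near. Qed.

End CubicGrowth.

Section PowerSpace.
Variables (k : fieldType) (A : algType k).
Implicit Types (S V : set A).

Lemma lin_spanM S S' S'' u v : linear_subspace S'' ->
  (forall x y, S x -> S' y -> S'' (x * y)) ->
  lin_span S u -> lin_span S' v -> S'' (u * v).
Proof.
move=> sS'' SM Su Sv.
have /(_ u) : (lin_span S `<=` [set x | S'' (x * v)])%classic.
  apply: lin_span_sub => [|x Sx].
    have [S0 SD] := sS''; split=> [|c x y Sx Sy] /=; first by rewrite mul0r.
    by rewrite mulrDl -scalerAl; apply: SD.
  have /(_ v) : (lin_span S' `<=` [set y | S'' (x * y)])%classic; last exact.
  apply: lin_span_sub => [|y Sy]; last exact: SM.
  have [S0 SD] := sS''; split=> [|c y z Sy Sz] /=; first by rewrite mulr0.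
  by rewrite mulrDr -scalerAr; apply: SD.
exact.
Qed.

Lemma power_space_subspace V m : linear_subspace (power_space V m).
Proof. exact: lin_span_subspace. Qed.

Lemma power_space_prod V m w :
  (size w <= m)%N -> (forall x, x \in w -> V x) ->
  power_space V m (\prod_(x <- w) x).
Proof. by move=> wm wV; apply: lin_span_gen; exists w. Qed.

Lemma power_spaceM V m n u v :
  power_space V m u -> power_space V n v -> power_space V (m + n) (u * v).
Proof.
apply: lin_spanM => [|_ _ [w [wm wV] <-] [w' [wm' wV'] <-]].
  exact: power_space_subspace.
rewrite -big_cat; apply: power_space_prod.
  by rewrite size_cat leq_add.
by move=> x; rewrite mem_cat => /orP[/wV|/wV'].
Qed.

Lemma power_space_mono V m n :
  (m <= n)%N -> (power_space V m `<=` power_space V n)%classic.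
Proof.
move=> mn; apply: lin_span_sub => [|_ [w [wm wV] <-]].
  exact: power_space_subspace.
by apply: power_space_prod => //; apply: leq_trans mn.
Qed.

(** Words in a finite spanning family of [V] span [V^m]. *)
Lemma power_space_finite_dim V m :
  finite_dim V -> finite_dim (power_space V m).
Proof.
move=> [n [t [_ Vt]]].
pose E := [seq t i | i <- enum 'I_n].
pose W := fix W m := if m is m'.+1
  then 1 :: [seq e * w | e <- E, w <- W m'] else [:: 1].
have W1 m' : 1 \in W m' by case: m' => [|m'] /=; rewrite inE eqxx.
apply: (@subspace_finite_dim _ _ _ (W m)); first exact: power_space_subspace.
apply: lin_span_sub => [|_ [w [wm wV] <-]]; first exact: lin_span_subspace.
elim: w m wm wV => [|x w IH] m; first by rewrite big_nil => _ _; apply/lin_span_gen/W1.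
case: m => [//|m] /= wm wV; rewrite big_cons.
have Ex : lin_span [set` E] x.
  have : V x by apply: wV; rewrite inE eqxx.
  rewrite Vt => -[c _ <-]; apply: subspace_sum; first exact: lin_span_subspace.
  move=> i _; apply: subspaceZ; first exact: lin_span_subspace.
  by apply: lin_span_gen; apply: map_f; rewrite mem_enum.
have Ww : lin_span [set` W m] (\prod_(y <- w) y).
  by apply: IH => // y yw; apply: wV; rewrite inE yw orbT.
apply: lin_spanM Ex Ww => [|e u eE uW]; first exact: lin_span_subspace.
by apply: lin_span_gen; rewrite /= inE; apply/orP; right; apply: allpairs_f.
Qed.

End PowerSpace.

Section TensorGrowth.
Variables (K L : fieldType) (iota : {rmorphism K -> L}) (A : algType K).
Local Notation T := (tensor iota A).
Implicit Types (V : set A) (u v : T).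

Lemma pureDr x : {morph (pure iota x : A -> T) : a b / a + b}.
Proof. by case: (tensor_pure_bilinear iota A). Qed.

Lemma pure0r x : pure iota x 0 = 0 :> T.
Proof. by apply: (addrI (pure iota x 0)); rewrite -pureDr !addr0. Qed.

Lemma pure1Z c a : pure iota 1 (c *: a) = iota c *: pure iota 1 a :> T.
Proof.
by case: (tensor_pure_bilinear iota A) => _ _ ->; rewrite pureZ.
Qed.

Lemma pureE x a : pure iota x a = x *: pure iota 1 a :> T.
Proof. by rewrite pureZ mulr1. Qed.

(** The scalar extension of [V^m], as a subspace of the extended algebra. *)
Definition tensor_degree V m : set T :=
  lin_span [set pure iota 1 a | a in power_space V m].

Lemma tensor_degreeM V m n u v :
  tensor_degree V m u -> tensor_degree V n v -> tensor_degree V (m + n) (u * v).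
Proof.
apply: lin_spanM => [|_ _ [a Va <-] [b Vb <-]]; first exact: lin_span_subspace.
rewrite pureM mulr1; apply: lin_span_gen; exists (a * b) => //.
exact: power_spaceM.
Qed.

Lemma tensor_degreeX V u i : tensor_degree V 1 u -> tensor_degree V i (u ^+ i).
Proof.
move=> Vu; elim: i => [|i IH]; last by rewrite exprS -add1n; apply: tensor_degreeM.
rewrite expr0 -pure11; apply: lin_span_gen; exists 1 => //.
by have := @power_space_prod _ _ V 0 [::]; rewrite big_nil; apply.
Qed.

Lemma tensor_degree_mono V m n :
  (m <= n)%N -> (tensor_degree V m `<=` tensor_degree V n)%classic.
Proof.
move=> mn; apply: lin_span_sub => [|_ [a Va <-]]; first exact: lin_span_subspace.
by apply: lin_span_gen; exists a => //; apply: power_space_mono Va.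
Qed.

Lemma tensor_degree_gen V u :
  (forall p, p \in repr u -> V p.2) -> tensor_degree V 1 u.
Proof.
move=> uV; rewrite [u]tensor_sum_pure big_seq_cond.
apply: subspace_sum => [|p]; first exact: lin_span_subspace.
rewrite andbT => /uV Vp; rewrite pureE.
apply: subspaceZ; first exact: lin_span_subspace.
apply: lin_span_gen; exists p.2 => //.
have := @power_space_prod _ _ V 1 [:: p.2]; rewrite big_seq1; apply=> // x.
by rewrite inE => /eqP ->.
Qed.

(** A basis of [V^m] over [K] still spans after extension of scalars, so the
    extension does not increase its dimension. *)
Lemma free_tensor_degree_le V m (I : finType) (t : I -> T) :
  finite_dim V ->
  (forall c : I -> L, \sum_i c i *: t i = 0 -> forall i, c i = 0) ->
  (forall i, tensor_degree V m (t i)) -> (#|I| <= Defs.dim (power_space V m))%N.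
Proof.
move=> fV tfree tV; have [d dE] := power_space_finite_dim m fV.
rewrite (dimE dE); case: dE => u [_ Vu].
apply: (@free_family_le _ _ _ (fun j => t (enum_val j)) _
          (fun i => pure iota 1 (u i))) => [c c0 j|j].
  have := tfree (fun i => c (enum_rank i)).
  rewrite (reindex (@enum_val _ I)) /=; last exact/onW_bij/enum_val_bij.
  move=> /(_ _ (enum_val j)); rewrite enum_valK; apply.
  by rewrite -[RHS]c0; apply: eq_bigr => i _; rewrite enum_valK.
move: (tV (enum_val j)); apply: lin_span_sub => [|_ [a + <-]].
  exact: range_lin_comb_subspace.
rewrite Vu => -[c _ <-]; rewrite /lin_comb (big_morph _ (pureDr 1) (pure0r 1)).
apply: subspace_sum => [|i _]; first exact: range_lin_comb_subspace.
rewrite pure1Z; apply: subspaceZ; first exact: range_lin_comb_subspace.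
exact: range_lin_comb_gen.
Qed.

(** Three elements of the extended algebra lie in the degree one part for a
    single [V], so [V^n] has dimension at least the number of the monomials
    of degree at most [n / 3] in each variable. *)
Lemma GKdim_ge3 (R : realType) (x y z : T) :
  (forall n (c : 'I_n * ('I_n * 'I_n) -> L),
     \sum_i c i *: (x ^+ i.1 * (y ^+ i.2.1 * z ^+ i.2.2)) = 0 ->
     forall i, c i = 0) ->
  (3%:E <= GKdim R A)%E.
Proof.
move=> xyz; pose E := [seq p.2 | p <- repr x ++ repr y ++ repr z].
pose V := lin_span [set` E].
have fV : finite_dim V.
  by apply: (@subspace_finite_dim _ _ _ E) => //; exact: lin_span_subspace.
have degV u : {subset repr u <= repr x ++ repr y ++ repr z} -> tensor_degree V 1 u.
  by move=> uE; apply: tensor_degree_gen => p /uE pE; apply/lin_span_gen/map_f.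
have Vx : tensor_degree V 1 x by apply: degV => p; rewrite !mem_cat => ->.
have Vy : tensor_degree V 1 y.
  by apply: degV => p; rewrite !mem_cat => ->; rewrite orbT.
have Vz : tensor_degree V 1 z.
  by apply: degV => p; rewrite !mem_cat => ->; rewrite !orbT.
apply: le_trans (ereal_sup_ubound _); last by exists V.
apply: cubic_growth_limn_esup => n; set m := (n %/ 3).+1.
have -> : (m ^ 3 = #|{: 'I_m * ('I_m * 'I_m)}|)%N.
  by rewrite !card_prod !card_ord !expnS muln1.
apply: free_tensor_degree_le fV (xyz m) _ => -[i [j l]] /=.
apply: (@tensor_degree_mono V (i + (j + l))).
  have := leq_trunc_div n 3; have := ltn_ord i; have := ltn_ord j.
  have := ltn_ord l; rewrite /m !ltnS => il jl ll; apply: leq_trans.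
  by rewrite mulnC !mulSn mul0n addn0 !leq_add.
by do 2?[apply: tensor_degreeM]; apply: tensor_degreeX.
Qed.

End TensorGrowth.

(** * Left independence over a centralizer *)

Section Twist.
Variables (G : unitRingType) (a : G).
Hypothesis divG : division_ring G.
Implicit Types (l t w x y : G) (s : seq G).

Lemma division_mulf_eq0 x y : x * y = 0 -> x = 0 \/ y = 0.
Proof.
have [->|x0 xy] := eqVneq x 0; first by left.
by right; apply: (mulrI (divG x0)); rewrite mulr0.
Qed.

Lemma division_mulf_neq0 x y : x != 0 -> y != 0 -> x * y != 0.
Proof. by move=> x0 y0; apply/eqP => /division_mulf_eq0[]; apply/eqP. Qed.

Lemma division_expf_neq0 x n : x != 0 -> x ^+ n != 0.
Proof.
move=> x0; elim: n => [|n IH]; first by rewrite expr0 oner_neq0.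
by rewrite exprS division_mulf_neq0.
Qed.

(** Right multiplication by [a], shifted by left multiplication by [x]: its
    kernel consists of the [w] with [w a = x w]. On left coefficients commuting
    with [x] it is linear. *)
Definition twist x w := w * a - x * w.

Lemma twistD x : {morph twist x : w w' / w + w'}.
Proof. by move=> w w'; rewrite /twist mulrDl mulrDr opprD addrACA. Qed.

Lemma twist0 x : twist x 0 = 0.
Proof. by rewrite /twist mul0r mulr0 subr0. Qed.

Lemma twistM x l w : GRing.comm x l -> twist x (l * w) = l * twist x w.
Proof. by move=> xl; rewrite /twist mulrBr !mulrA xl. Qed.

Lemma twistC x y w :
  GRing.comm x y -> twist x (twist y w) = twist y (twist x w).
Proof.
move=> xy; rewrite /twist !mulrBl !mulrBr !opprB !mulrA xy.
by rewrite addrACA [RHS]addrACA; congr (_ + _); rewrite addrC.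
Qed.

Definition twists s w := foldr twist w s.

Lemma twists_twist s x w : {in s, forall y, GRing.comm x y} ->
  twist x (twists s w) = twists s (twist x w).
Proof.
elim: s => [//|y s IH] xs /=; rewrite twistC ?IH // => [z zs|].
  by apply: xs; rewrite inE zs orbT.
by apply: xs; rewrite inE eqxx.
Qed.

Lemma twists0 s : twists s 0 = 0.
Proof. by elim: s => //= x s ->; rewrite twist0. Qed.

(** The factors commute, so those attached to [x] may be applied first. *)
Lemma twists_eq0 s x m w : {in s, forall y, GRing.comm x y} ->
  (m <= count_mem x s)%N -> iter m (twist x) w = 0 -> twists s w = 0.
Proof.
elim: s m w => [|y s IH] m w xs /=.
  by rewrite leqn0 => /eqP ->.
have xs' : {in s, forall y, GRing.comm x y}.
  by move=> z zs; apply: xs; rewrite inE zs orbT.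
have [->|_] := eqVneq y x; last by move=> mc w0; rewrite (IH m) // twist0.
case: m => [_ /= -> | m mc w0]; first by rewrite twists0 twist0.
by rewrite twists_twist // (IH m) // -iterSr.
Qed.

(** On a right eigenvector of eigenvalue [x] the factor attached to [y] acts as
    left multiplication by [x - y], and preserves the eigenspace. *)
Lemma twists_neq0 s x t : {in s, forall y, GRing.comm x y /\ y != x} ->
  t * a = x * t -> t != 0 -> twists s t != 0.
Proof.
move=> xs ta t0; suff [] : twists s t * a = x * twists s t /\ twists s t != 0 by [].
elim: s xs => [//|y s IH] xs /=.
have [|ya y0] := IH; first by move=> z zs; apply: xs; rewrite inE zs orbT.
have [xy yx] : GRing.comm x y /\ y != x by apply: xs; rewrite inE eqxx.
rewrite /twist ya -mulrBl; split.
  by rewrite -mulrA ya !mulrA; congr (_ * _); apply/commr_sym/commrB.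
by rewrite division_mulf_neq0 // subr_eq0 eq_sym.
Qed.

Lemma twistsM s l w :
  {in s, forall y, GRing.comm y l} -> twists s (l * w) = l * twists s w.
Proof.
elim: s => [//|y s IH] sl /=; rewrite IH => [|z zs]; last first.
  by apply: sl; rewrite inE zs orbT.
by rewrite twistM //; apply: sl; rewrite inE eqxx.
Qed.

Lemma twistsD s : {morph twists s : w w' / w + w'}.
Proof. by move=> w w'; elim: s => //= y s ->; rewrite twistD. Qed.

(** Independence of generalized eigenvectors. With values in the commutative
    ring of the elements that commute with [a], right multiplication by [a] has
    the [x i] as eigenvalues, [h i] is the exact height of [w i], and no two of
    the [w i] share both. In a relation, pick a term of maximal height with a
    nonzero coefficient: a suitable product of shifted operators kills all
    other terms and turns this one into an eigenvector. *)
Lemma left_free_twist (I : finType) (x w : I -> G) (h : I -> nat) (l : I -> G) :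
  (forall y z, GRing.comm a y -> GRing.comm a z -> GRing.comm y z) ->
  (forall i, GRing.comm a (x i)) ->
  (forall i, iter (h i).+1 (twist (x i)) (w i) = 0) ->
  (forall i, iter (h i) (twist (x i)) (w i) != 0) ->
  (forall i j, x i = x j -> h i = h j -> i = j) ->
  (forall i, GRing.comm a (l i)) ->
  \sum_i l i * w i = 0 -> forall i, l i = 0.
Proof.
move=> comL Lx whigh wlow xh_inj Ll lw0 i'; apply/eqP/negPn/negP => li'.
have [i li imax] := @arg_maxnP _ i' (fun i => l i != 0) h li'.
(* [s0] collects the other eigenvalues, each often enough to kill the
   generalized eigenvectors that belong to it. *)
pose s0 := flatten [seq nseq (h j).+1 (x j) | j <- enum I & x j != x i].
pose s := s0 ++ nseq (h i) (x i).
have s0P y : y \in s0 -> exists2 j, y = x j & x j != x i.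
  case/flattenP => _ /mapP[j + ->]; rewrite mem_filter => /andP[ji _].
  by rewrite mem_nseq => /andP[_ /eqP ->]; exists j.
have Ls y : y \in s -> GRing.comm a y.
  rewrite mem_cat => /orP[/s0P[j ->]//|]; rewrite mem_nseq => /andP[_ /eqP ->].
  exact: Lx.
have kill j : j != i -> twists s (l j * w j) = 0.
  move=> ji; have [->|lj] := eqVneq (l j) 0; first by rewrite mul0r twists0.
  rewrite twistsM => [|y /Ls yL]; last exact: comL.
  rewrite (@twists_eq0 _ (x j) (h j).+1) ?mulr0 // => [y /Ls yL|]; first exact: comL.
  rewrite count_cat; have [xji|xji] := eqVneq (x j) (x i).
    rewrite count_nseq /= xji eqxx mul1n (leq_trans _ (leq_addl _ _)) //.
    rewrite ltn_neqAle [X in _ && X]imax // andbT; apply: contraNneq ji => hji.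
    by apply/eqP/xh_inj.
  rewrite (leq_trans _ (leq_addr _ _)) // count_flatten -map_comp sumnE big_map.
  have jr : j \in [seq j <- enum I | x j != x i] by rewrite mem_filter xji mem_enum.
  rewrite (big_rem j) //= (leq_trans _ (leq_addr _ _)) //.
  by rewrite count_nseq /= eqxx mul1n.
have iterE m y v : twists (nseq m y) v = iter m (twist y) v.
  by elim: m => //= m ->.
have : twists s (\sum_j l j * w j) != 0.
  rewrite (big_morph _ (twistsD s) (twists0 s)) (bigD1 i) //=.
  rewrite big1 ?addr0 // twistsM => [|y /Ls yL]; last exact: comL.
  apply: division_mulf_neq0 => //; rewrite /twists foldr_cat -/(twists _ _).
  rewrite -/(twists _ _) iterE; apply: (@twists_neq0 _ (x i)) => //.
    by move=> _ /s0P[j -> ji]; split=> //; apply: comL.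
  by apply/eqP; rewrite -subr_eq0; apply/eqP/whigh.
by rewrite lw0 twists0 eqxx.
Qed.

End Twist.

(** * Eigenvectors of inner derivations in a division algebra *)

Section DivisionAlgebra.
Variables (k : closedFieldType) (G : unitAlgType k).
Hypothesis divG : division_ring G.
Hypothesis ccG : commutative_centralizer_condition G.
Implicit Types (a b c u v w x y z : G) (lam mu : k).

Lemma centre_scalar lam : centre (lam%:A : G).
Proof. by move=> x; rewrite mulr_algl mulr_algr. Qed.

(** Over an algebraically closed field a polynomial relation for [a] splits into
    linear factors, one of which would make [a] a scalar. *)
Lemma noncentral_transcendental a n (c : 'I_n -> k) : ~ centre a ->
  \sum_i c i *: a ^+ i = 0 -> forall i, c i = 0.
Proof.
move=> na c0; pose p := \sum_i c i *: 'X^i : {poly k}.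
suff p0 : p = 0.
  move=> i; have := congr1 (fun q : {poly k} => q`_i) p0.
  rewrite coef0 coef_sum (bigD1 i) //= coefZ coefXn eqxx mulr1 big1 ?addr0 // => j ji.
  by rewrite coefZ coefXn val_eqE eq_sym (negbTE ji) mulr0.
have pa0 : horner_alg a p = 0.
  rewrite -[RHS]c0 raddf_sum; apply: eq_bigr => i _ /=.
  by rewrite linearZ rmorphXn /= horner_algX mulr_algl.
apply/eqP/negPn/negP => p_neq0; have [r pE] := closed_field_poly_normal p.
move: pa0; rewrite pE linearZ rmorph_prod /= mulr_algl => /eqP.
rewrite scaler_eq0 lead_coef_eq0 (negbTE p_neq0) /=; apply/negP.
elim: r {pE} => [|x r IH]; first by rewrite big_nil oner_neq0.
rewrite big_cons division_mulf_neq0 // rmorphB /= horner_algX horner_algC subr_eq0.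
by apply/eqP => ax; apply: na; rewrite ax; exact: centre_scalar.
Qed.

(** A condition on the monomials [y^i z^j] under which [a], [y], [z] generate
    an algebra of cubic growth. *)
Definition monomials_left_free a y z : Prop :=
  forall n (l : 'I_n * 'I_n -> G), (forall i, GRing.comm a (l i)) ->
    \sum_i l i * (y ^+ i.1 * z ^+ i.2) = 0 -> forall i, l i = 0.

Lemma monomials_free a y z : ~ centre a -> monomials_left_free a y z ->
  forall n (c : 'I_n * ('I_n * 'I_n) -> k),
    \sum_i c i *: (a ^+ i.1 * (y ^+ i.2.1 * z ^+ i.2.2)) = 0 ->
    forall i, c i = 0.
Proof.
move=> na free n c c0 [i j].
pose l j := \sum_i c (i, j) *: a ^+ i.
suff /(noncentral_transcendental na) : l j = 0 by exact.
move: j; apply: free => [j|].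
  by apply: commr_sum => i' _; rewrite /GRing.comm -scalerAr -scalerAl -exprS -exprSr.
transitivity (\sum_j \sum_i c (i, j) *: (a ^+ i * (y ^+ j.1 * z ^+ j.2))).
  by apply: eq_bigr => j _; rewrite mulr_suml; apply: eq_bigr => i' _; rewrite scalerAl.
rewrite exchange_big -[RHS]c0 pair_bigA /=.
by apply: eq_bigr => -[].
Qed.

Lemma eigenvector_noncentral a u lam :
  ad a u = lam *: u -> lam != 0 -> u != 0 -> ~ centre a.
Proof.
move=> au lam0 u0 za; move: au; rewrite /ad za subrr => /esym/eqP.
by rewrite scaler_eq0 (negbTE lam0) (negbTE u0).
Qed.

Lemma pchar0_natr_inj (F : fieldType) :
  [pchar F] =i pred0 -> injective (fun n => n%:R : F).
Proof.
move=> F0 m n; wlog mn : m n / (m <= n)%N => [hw mnE|mnE].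
  by case: (leqP m n) => [/hw->//|/ltnW/hw-> //].
apply/eqP; rewrite eqn_leq mn -subn_eq0 -((pcharf0P F).1 F0) natrB //.
by rewrite /= [m%:R](mnE : _ = n%:R) subrr.
Qed.

Section JordanBlock.
Variables (a b c : G) (lam : k).
Hypothesis k0 : [pchar k] =i pred0.
Hypothesis ac : ad a c = lam *: c.
Hypothesis ab : ad a b = lam *: b + c.

(** Up to sign, [ad a - n lam]; the additive dependence on [n] makes it obey the
    Leibniz rule on products of generalized eigenvectors. *)
Let delta n := twist a (a - (n%:R * lam)%:A).

Let deltaE n w : delta n w = (n%:R * lam) *: w - ad a w.
Proof. by rewrite /delta /twist /ad mulrBl mulr_algl !opprB addrCA. Qed.

Let deltaMc n w : delta n.+1 (w * c) = delta n w * c.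
Proof.
rewrite !deltaE adM ac -scalerAr [RHS]mulrBl -scalerAl -natr1 mulrDl mul1r scalerDl.
by rewrite opprD addrACA subrr addr0.
Qed.

Let deltaMb n w : delta n.+1 (w * b) = delta n w * b - w * c.
Proof.
rewrite !deltaE adM ab mulrDr -scalerAr [X in _ = X - _]mulrBl -scalerAl -natr1 mulrDl mul1r.
by rewrite scalerDl !opprD addrACA [in X in _ + X]addrA subrr add0r.
Qed.

Let delta_cX n : delta n (c ^+ n) = 0.
Proof.
elim: n => [|n IH]; last by rewrite exprSr deltaMc IH mul0r.
by rewrite deltaE mul0r scale0r /ad expr0 mulr1 mul1r subrr subr0.
Qed.

Let deltaZ n mu w : delta n (mu *: w) = mu *: delta n w.
Proof. by rewrite /delta /twist -scalerAl -scalerAr scalerBr. Qed.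

Let deltaB n w w' : delta n (w - w') = delta n w - delta n w'.
Proof. by rewrite -[- w']scaleN1r [LHS]twistD [X in _ + X]deltaZ scaleN1r. Qed.

(** The Leibniz formula; it has only two terms since the shifted operator kills
    [c]. *)
Let iter_deltaMb m n w : iter m.+1 (delta n.+1) (w * b) =
  iter m.+1 (delta n) w * b - m.+1%:R *: (iter m (delta n) w * c).
Proof.
elim: m => [|m IH]; first by rewrite /= deltaMb scale1r.
rewrite iterS IH deltaB deltaMb deltaZ deltaMc -addrA -opprD [X in - X]addrC.
by rewrite -!iterS -[m.+2](addn1 m.+1) natrD scalerDl scale1r.
Qed.

Let iter_delta_bX n : iter n (delta n) (b ^+ n) = ((-1) ^+ n * n`!%:R) *: c ^+ n.
Proof.
elim: n => [|n IH]; first by rewrite mul1r scale1r.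
rewrite exprSr iter_deltaMb iterS IH deltaZ delta_cX scaler0 mul0r add0r.
rewrite -scalerAl -exprSr scalerA -scaleNr factS natrM [(-1) ^+ n.+1]exprS; congr (_ *: _).
by rewrite mulN1r !mulNr mulrCA.
Qed.

Let iter_deltaMcX m n i w :
  iter m (delta (n + i)) (w * c ^+ i) = iter m (delta n) w * c ^+ i.
Proof.
elim: m => [//|m IH]; rewrite !iterS IH; elim: i {IH} => [|i IH].
  by rewrite addn0 !mulr1.
by rewrite addnS !exprSr !mulrA deltaMc IH.
Qed.

(** [b^i c^j] has height exactly [i], and its eigenvalue for [ad a] is
    [(i + j) lam]; these two numbers determine [i] and [j]. *)
Lemma jordan_left_free :
  c != 0 -> lam != 0 -> monomials_left_free a b c.
Proof.
move=> c0 lam0 n l Ll.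
have na : ~ centre a := eigenvector_noncentral ac lam0 c0.
have iterE (i : 'I_n * 'I_n) : iter i.1 (delta (i.1 + i.2)) (b ^+ i.1 * c ^+ i.2) =
    ((-1) ^+ i.1 * (i.1)`!%:R) *: c ^+ (i.1 + i.2).
  by rewrite iter_deltaMcX iter_delta_bX -scalerAl -exprD.
have natk0 m : (m%:R == 0 :> k) = (m == 0%N) by move/pcharf0P: k0.
move=> lw0; refine (@left_free_twist G a divG _
  (fun i : 'I_n * 'I_n => a - ((i.1 + i.2)%:R * lam)%:A)
  (fun i => b ^+ i.1 * c ^+ i.2) (fun i => i.1) l _ _ _ _ _ Ll lw0).
- by move=> y z; apply: comm_trans.
- by move=> i; apply: commrB => //; apply/comm_centre/centre_scalar.
- by move=> i; rewrite iterS [iter _ _ _]iterE [twist _ _ _]deltaZ delta_cX scaler0.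
- move=> i; rewrite [iter _ _ _]iterE scaler_eq0 mulf_eq0 signr_eq0 natk0.
  by rewrite -leqn0 leqNgt fact_gt0 /= division_expf_neq0.
move=> [i1 i2] [j1 j2] /= /addrI/oppr_inj/eqP + ij.
rewrite -subr_eq0 -scalerBl scaler_eq0 oner_eq0 orbF -mulrBl mulf_eq0.
rewrite (negbTE lam0) orbF subr_eq0 => /eqP/(pchar0_natr_inj k0) ijE.
by congr (_, _); apply/val_inj => //; apply: (@addnI i1); rewrite ijE ij.
Qed.

End JordanBlock.

Definition conj_by w x := w * x / w.

Lemma conj_by_eq w x y : w != 0 -> y * w = w * x -> conj_by w x = y.
Proof. by move=> w0 yw; rewrite /conj_by -yw mulrK // divG. Qed.

Lemma conj_byE w x : w != 0 -> conj_by w x * w = w * x.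
Proof. by move=> w0; rewrite /conj_by mulrVK // divG. Qed.

Lemma conj_byM v w x : v != 0 -> w != 0 ->
  conj_by (v * w) x = conj_by v (conj_by w x).
Proof. by move=> v0 w0; rewrite /conj_by invrM ?divG // !mulrA. Qed.

Lemma conj_byD w : {morph conj_by w : x y / x + y}.
Proof. by move=> x y; rewrite /conj_by mulrDr mulrDl. Qed.

Lemma conj_byN w : {morph conj_by w : x / - x}.
Proof. by move=> x; rewrite /conj_by mulrN mulNr. Qed.

Lemma conj_byZ w lam : {morph conj_by w : x / lam *: x}.
Proof. by move=> x; rewrite /conj_by -scalerAr -scalerAl. Qed.

Lemma conj_by_scalar w lam : w != 0 -> conj_by w lam%:A = lam%:A.
Proof. by move=> w0; apply: conj_by_eq => //; apply: centre_scalar. Qed.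

Lemma conj_by_inj w : w != 0 -> injective (conj_by w).
Proof.
move=> w0 x y /(congr1 (fun z => z * w)); rewrite !conj_byE //.
by apply/mulrI/divG.
Qed.

Lemma conj_by_comm w x y : w != 0 ->
  GRing.comm x y -> GRing.comm (conj_by w x) (conj_by w y).
Proof.
by move=> w0 xy; rewrite /GRing.comm /conj_by !mulrA !divrK ?divG // -[w * x * y]mulrA xy !mulrA.
Qed.

Lemma conj_by_eigenX a u lam n : u != 0 -> ad a u = lam *: u ->
  conj_by (u ^+ n) a = a - (n%:R * lam)%:A.
Proof.
move=> u0 au; elim: n => [|n IH].
  by rewrite expr0 mul0r scale0r subr0 /conj_by mul1r divr1.
rewrite exprS conj_byM ?division_expf_neq0 // IH conj_byD conj_byN conj_by_scalar //.
rewrite (@conj_by_eq _ _ (a - lam%:A)) //.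
  by rewrite -addrA -opprD -scalerDl -natr1 mulrDl mul1r [lam + _]addrC.
by rewrite mulrBl mulr_algl -au /ad opprB addrC subrK.
Qed.

(** Conjugation by [u] and by [v] acts on the field [C(a) = C(b)], the first
    translating [a], the second translating [b]. If the automorphisms
    induced by the [u^i v^j] are distinct then these monomials are independent
    over that field, being right eigenvectors of [a]. Otherwise some positive
    power of [u] translates [b] as well as [a], hence fixes a combination
    [b - kap a], which then commutes with the noncommuting [a] and [u^m]. *)
Lemma rigid_or_left_free a b u v lam mu : [pchar k] =i pred0 ->
  GRing.comm a b -> ad a u = lam *: u -> ad b v = mu *: v ->
  u != 0 -> v != 0 -> lam != 0 -> mu != 0 ->
  monomials_left_free a u v \/ exists kap, centre (b - kap *: a).
Proof.
move=> k0 ab au bv u0 v0 lam0 mu0.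
have na := eigenvector_noncentral au lam0 u0.
have nb := eigenvector_noncentral bv mu0 v0.
have [|nkap] := EM (exists kap, centre (b - kap *: a)); [by right|left=> n l Ll lw0].
pose w (i : 'I_n * 'I_n) := u ^+ i.1 * v ^+ i.2.
have w0 i : w i != 0 by rewrite division_mulf_neq0 // division_expf_neq0.
have conju x : GRing.comm a x -> GRing.comm a (conj_by u x).
  move=> ax; have : GRing.comm (conj_by u a) (conj_by u x) by exact: conj_by_comm.
  rewrite -[u in conj_by u a]expr1 (conj_by_eigenX _ u0 au) => /commr_sym aux.
  apply/commr_sym; rewrite -[a](subrK (1%:R * lam)%:A).
  by apply: commrD => //; apply/comm_centre/centre_scalar.
have conjv x : GRing.comm a x -> GRing.comm a (conj_by v x).
  move=> ax; apply: (@comm_trans _ b _ _ ccG nb); first (exact: commr_sym ab).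
  have : GRing.comm (conj_by v b) (conj_by v x).
    by apply: conj_by_comm => //; exact: comm_trans ccG na ab ax.
  rewrite -[v in conj_by v b]expr1 (conj_by_eigenX _ v0 bv) => /commr_sym bvx.
  apply/commr_sym; rewrite -[b](subrK (1%:R * mu)%:A).
  by apply: commrD => //; apply/comm_centre/centre_scalar.
have conjX z x m : z != 0 -> (forall x, GRing.comm a x -> GRing.comm a (conj_by z x)) ->
    GRing.comm a x -> GRing.comm a (conj_by (z ^+ m) x).
  move=> z0 cz ax; elim: m => [|m IH]; first by rewrite /conj_by mul1r divr1.
  by rewrite exprS conj_byM ?division_expf_neq0 //; apply: cz.
refine (@left_free_twist G a divG _ (fun i => conj_by (w i) a) w (fun=> 0%N)
  l _ _ _ _ _ Ll lw0) => [y z|i|i|//|i j /= wij _].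
- exact: comm_trans.
- rewrite conj_byM ?division_expf_neq0 //.
  exact: conjX u0 conju (conjX _ _ _ v0 conjv _).
- by rewrite /= /twist conj_byE // subrr.
(* [w j^-1 * w i] commutes with [a], hence with [b]. *)
have wij_b : conj_by (w i) b = conj_by (w j) b.
  have wa : GRing.comm a ((w j)^-1 * w i).
    apply: (mulrI (divG (w0 j))); rewrite -[_ * w i * a]mulrA mulVKr ?divG //.
    by rewrite mulrA -(conj_byE a (w0 j)) -mulrA mulVKr ?divG // -wij conj_byE.
  have wb := comm_trans ccG na ab wa.
  apply: conj_by_eq => //; rewrite -[in LHS](mulVKr (divG (w0 j)) (w i)).
  by rewrite [LHS]mulrA conj_byE // -mulrA wb [LHS]mulrA mulVKr ?divG.
have wb p : conj_by (w p) b = conj_by (u ^+ p.1) b - (p.2%:R * mu)%:A.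
  rewrite /w conj_byM ?division_expf_neq0 // (conj_by_eigenX _ v0 bv).
  by rewrite conj_byD conj_byN conj_by_scalar ?division_expf_neq0.
(* If [p.1 <= q.1], cancelling [u ^+ p.1] leaves a relation for the power
   [m := q.1 - p.1] of [u]. *)
have key (p q : 'I_n * 'I_n) : (p.1 <= q.1)%N -> conj_by (w p) b = conj_by (w q) b -> p = q.
  move=> pq; rewrite !wb -(subnKC pq) exprD conj_byM ?division_expf_neq0 //.
  move: (q.1 - p.1)%N (subnKC pq) => m pqm.
  set nu : k := (q.2%:R - p.2%:R) * mu => uE.
  have {uE} ub : conj_by (u ^+ m) b = b + nu%:A.
    apply: (@conj_by_inj (u ^+ p.1)); first exact: division_expf_neq0.
    rewrite conj_byD conj_by_scalar ?division_expf_neq0 //.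
    rewrite -[LHS](subrK (q.2%:R * mu)%:A) -uE -addrA; congr (_ + _).
    by rewrite /nu mulrBl scalerBl addrC.
  case: m ub pqm => [|m] ub pqm.
    move: ub; rewrite expr0 /conj_by mul1r divr1 -[in LHS](addr0 b) => /addrI.
    move=> /esym/eqP; rewrite scaler_eq0 oner_eq0 orbF mulf_eq0 (negbTE mu0) orbF.
    rewrite subr_eq0 => /eqP/(pchar0_natr_inj k0) qp.
    case: p q qp pqm {wb pq nu} => [p1 p2] [q1 q2] /= qp pq.
    by congr (_, _); apply/val_inj => //=; rewrite -pq addn0.
  have natm0 : m.+1%:R * lam != 0.
    by rewrite mulf_neq0 // ((pcharf0P k).1 k0).
  (* [kap] is chosen so that the translations of [b] and of [kap *: a] by
     [u ^+ m.+1] cancel. *)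
  case: nkap; exists (- (nu / (m.+1%:R * lam))); rewrite scaleNr opprK.
  apply: contrapT => ne; set e := b + _ in ne.
  have ea : GRing.comm e a.
    by apply/commr_sym/commrD => //; rewrite /GRing.comm -scalerAr scalerAl.
  have eu : GRing.comm e (u ^+ m.+1).
    rewrite /GRing.comm -[in RHS]conj_byE ?division_expf_neq0 //; congr (_ * _).
    rewrite /e conj_byD conj_byZ (conj_by_eigenX _ u0 au) ub scalerBr scalerA.
    by rewrite divfK // addrACA addrA addrK.
  have := comm_trans ccG ne ea eu; rewrite /GRing.comm => aum.
  have := conj_by_eigenX m.+1 u0 au; rewrite (@conj_by_eq _ _ a) ?division_expf_neq0 //.
  rewrite -[in LHS](subr0 a) => /addrI/oppr_inj/esym/eqP.
  by rewrite scaler_eq0 oner_eq0 orbF (negbTE natm0).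
by case: (leqP i.1 j.1) => [/key/(_ wij_b)|/ltnW/key/(_ (esym wij_b))].
Qed.

End DivisionAlgebra.

(** * Polynomials in a linear operator *)

Section OperatorPoly.
Variables (k : fieldType) (V : lmodType k) (f : V -> V).
Hypothesis fD : {morph f : u v / u + v}.
Hypothesis fZ : forall c, {morph f : u / c *: u}.
Implicit Types (u v w : V) (p q : {poly k}).

Let f0 : f 0 = 0.
Proof. by rewrite -[0 in LHS](scale0r 0) fZ scale0r. Qed.

Let fB : {morph f : u v / u - v}.
Proof. by move=> u v; rewrite fD -scaleN1r fZ scaleN1r. Qed.

Let iterD i : {morph iter i f : u v / u + v}.
Proof. by move=> u v; elim: i => //= i ->; rewrite fD. Qed.

Let iterZ i c : {morph iter i f : u / c *: u}.
Proof. by move=> u; elim: i => //= i ->; rewrite fZ. Qed.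

Definition operator_poly p v : V := \sum_(i < size p) p`_i *: iter i f v.

Lemma operator_poly_widen n p v : (size p <= n)%N ->
  operator_poly p v = \sum_(i < n) p`_i *: iter i f v.
Proof.
move=> pn; rewrite /operator_poly (big_ord_widen n (fun i => p`_i *: iter i f v) pn).
rewrite big_mkcond; apply: eq_bigr => i _; case: ltnP => // pi.
by rewrite nth_default // scale0r.
Qed.

Lemma operator_polyD p q v :
  operator_poly (p + q) v = operator_poly p v + operator_poly q v.
Proof.
pose n := maxn (size p) (size q).
rewrite !(@operator_poly_widen n) ?leq_maxl ?leq_maxr ?size_polyD // -big_split.
by apply: eq_bigr => i _; rewrite coefD scalerDl.
Qed.

Lemma operator_polyZ c p v : operator_poly (c *: p) v = c *: operator_poly p v.
Proof.
rewrite !(@operator_poly_widen (size p)) ?size_scale_leq // scaler_sumr.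
by apply: eq_bigr => i _; rewrite coefZ scalerA.
Qed.

Lemma operator_poly_addv p : {morph operator_poly p : u v / u + v}.
Proof.
by move=> u v; rewrite -big_split; apply: eq_bigr => i _; rewrite iterD scalerDr.
Qed.

Lemma operator_poly_scalev p c : {morph operator_poly p : u / c *: u}.
Proof.
move=> u; rewrite scaler_sumr; apply: eq_bigr => i _.
by rewrite iterZ !scalerA mulrC.
Qed.

Lemma operator_poly0v p : operator_poly p 0 = 0.
Proof. by rewrite -[0 in LHS](scale0r 0) operator_poly_scalev scale0r. Qed.

Lemma operator_polyC c v : operator_poly c%:P v = c *: v.
Proof.
rewrite (@operator_poly_widen 1) ?size_polyC ?leq_b1 //.
by rewrite big_ord1 coefC.
Qed.

Lemma operator_polyMX p v : operator_poly (p * 'X) v = operator_poly p (f v).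
Proof.
rewrite (@operator_poly_widen (size p).+1); last first.
  by rewrite (leq_trans (size_polyMleq _ _)) // size_polyX addn2.
rewrite big_ord_recl coefMX scale0r add0r; apply: eq_bigr => i _.
by rewrite coefMX /= -iterS iterSr.
Qed.

Lemma operator_polyX v : operator_poly 'X v = f v.
Proof. by rewrite -['X]mul1r operator_polyMX -polyC1 operator_polyC scale1r. Qed.

Lemma operator_poly_comm p v : operator_poly p (f v) = f (operator_poly p v).
Proof.
rewrite /operator_poly (big_morph f fD f0); apply: eq_bigr => i _.
by rewrite fZ -iterSr.
Qed.

Lemma operator_polyM p q v :
  operator_poly (p * q) v = operator_poly p (operator_poly q v).
Proof.
elim/poly_ind: p v => [|p c IH] v.
  by rewrite mul0r -polyC0 !operator_polyC !scale0r.
rewrite mulrDl !operator_polyD mul_polyC operator_polyZ operator_polyC.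
by rewrite -mulrA -commr_polyX mulrA !operator_polyMX IH operator_poly_comm.
Qed.

Lemma operator_poly_eigen p lam v :
  f v = lam *: v -> operator_poly p v = p.[lam] *: v.
Proof.
move=> fv; rewrite horner_coef scaler_suml; apply: eq_bigr => i _.
suff -> : iter i f v = lam ^+ i *: v by rewrite scalerA.
by elim: (nat_of_ord i) => [|j IH]; rewrite ?scale1r //= IH fZ fv scalerA -exprSr.
Qed.

(** Without Jordan blocks, a vector killed by a split polynomial is a sum of
    eigenvectors: peel off one factor ['X - r], solve [(f - r) x = y]
    on the eigenvectors in [y] of eigenvalue different from [r], and
    note that the difference is killed by [(f - r)^2]. *)
Lemma sum_of_eigenvectors (rs : seq k) v :
  (forall r u, f (f u - r *: u) = r *: (f u - r *: u) -> f u = r *: u) ->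
  operator_poly (\prod_(r <- rs) ('X - r%:P)) v = 0 ->
  exists2 s : seq (k * V), (forall e, e \in s -> f e.2 = e.1 *: e.2) &
    v = \sum_(e <- s) e.2.
Proof.
move=> nojordan; elim: rs v => [|r rs IH] v.
  rewrite big_nil -polyC1 operator_polyC scale1r => ->.
  by exists [::] => //; rewrite big_nil.
rewrite big_cons mulrC operator_polyM operator_polyD -polyCN operator_polyC.
rewrite operator_polyX scaleNr.
move=> /IH[s seig vE].
pose t := [seq (e.1, (e.1 - r)^-1 *: e.2) | e <- s & e.1 != r].
have teig e : e \in t -> f e.2 = e.1 *: e.2.
  case/mapP => e'; rewrite mem_filter => /andP[_ /seig e'eig] -> /=.
  by rewrite fZ e'eig !scalerA mulrC.
pose y := \sum_(e <- t) e.2; pose x := v - y.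
have yE : f y - r *: y = \sum_(e <- s | e.1 != r) e.2.
  rewrite /y /t big_map big_filter (big_morph f fD f0) scaler_sumr -sumrB.
  rewrite big_seq_cond [RHS]big_seq_cond; apply: eq_bigr => e /andP[/seig ee er].
  rewrite /= fZ ee !scalerA -scalerBl [r * _]mulrC -mulrBr mulVf ?scale1r //.
  by rewrite subr_eq0.
have xE : f x - r *: x = \sum_(e <- s | e.1 == r) e.2.
  have -> : f x - r *: x = (f v - r *: v) - (f y - r *: y).
    rewrite /x fB scalerBr !opprB [LHS]addrACA [RHS]addrACA; congr (_ + _).
    exact: addrC.
  by rewrite yE vE (bigID (fun e => e.1 == r)) /= addrK.
exists ((r, x) :: t) => [e|]; last by rewrite big_cons subrK.
rewrite inE => /orP[/eqP ->|/teig//]; apply: nojordan.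
rewrite xE (big_morph f fD f0) scaler_sumr big_seq_cond [RHS]big_seq_cond.
by apply: eq_bigr => e' /andP[/seig -> /eqP ->].
Qed.

End OperatorPoly.

Lemma operator_poly_subspace (k : fieldType) (V : lmodType k) (f : V -> V) v :
  linear_subspace [set operator_poly f p v | p in [set: {poly k}]].
Proof.
split=> [|c _ _ [p _ <-] [q _ <-]].
  by exists 0 => //; rewrite /operator_poly size_poly0 big_ord0.
by exists (c *: p + q) => //; rewrite operator_polyD operator_polyZ.
Qed.

(** * Descent from the extended algebra *)

Section Descent.
Variables (K L : fieldType) (iota : {rmorphism K -> L}) (A : algType K).
Local Notation T := (tensor iota A).
Local Notation emb := (pure iota (1 : L) : A -> T).
Implicit Types (a b z : A) (u : T).

(** Any linear form on [L], seen as an algebra over [K], that takes the value 1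
    at 1 will do. *)
Lemma scalar_retraction : exists r : L -> K,
  [/\ {morph r : x y / x + y}, forall c x, r (iota c * x) = c * r x & r 1 = 1].
Proof.
pose scale (c : K) (x : L) := iota c * x.
have scaleA c d x : scale c (scale d x) = scale (c * d) x.
  by rewrite /scale rmorphM mulrA.
have scale1 : left_id 1 scale by move=> x; rewrite /scale rmorph1 mul1r.
have scaleDr : right_distributive scale +%R by move=> c x y; apply: mulrDr.
have scaleDl x : {morph scale^~ x : c d / c + d}.
  by move=> c d; rewrite /scale rmorphD mulrDl.
have scaleAl c x y : scale c (x * y) = scale c x * y by apply: mulrA.
have scaleAr c x y : scale c (x * y) = x * scale c y by apply: mulrCA.
pose lmod := GRing.Zmodule_isLmodule.Build K L scaleA scale1 scaleDr scaleDl.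
pose Lmod : lmodType K := HB.pack L lmod.
pose lalg := GRing.Lmodule_isLalgebra.Build K Lmod scaleAl.
pose Lalg : lalgType K := HB.pack L lmod lalg.
pose alg := GRing.Lalgebra_isAlgebra.Build K Lalg scaleAr.
pose Lalgebra : algType K := HB.pack L lmod lalg alg.
by have [r [rD rZ r1]] := linear_form_one Lalgebra; exists r.
Qed.

(** Used to descend an identity [emb b = kap *: emb a] to [b = r kap *: a]. *)
Lemma tensor_retraction : exists (r : L -> K) (f : T -> A),
  [/\ {morph f : u v / u + v}, forall x a, f (x *: emb a) = r x *: a & r 1 = 1].
Proof.
have [r [rD rZ r1]] := scalar_retraction.
have fb : bilinear_map iota (fun x a => r x *: a).
  split=> [a x y|x a b|c x a|c x a] /=.
  - by rewrite rD scalerDl.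
  - by rewrite scalerDr.
  - by rewrite rZ scalerA.
  - by rewrite !scalerA mulrC.
exists r, (tensor_lift (fun x a => r x *: a)); split=> // [|x a].
  exact: tensor_liftD.
by rewrite -pureE tensor_lift_pure.
Qed.

Lemma emb_inj : injective emb.
Proof.
have [r [f [fD fZ r1]]] := tensor_retraction.
by move=> a b ab; rewrite -[a]scale1r -[b]scale1r -r1 -!fZ ab.
Qed.

Lemma emb0 : emb 0 = 0. Proof. exact: pure0r. Qed.

Lemma embB : {morph emb : a b / a - b}.
Proof.
by move=> a b; rewrite pureDr -[- b]scaleN1r pure1Z rmorphN1 scaleN1r.
Qed.

Lemma emb_eq0 a : emb a = 0 -> a = 0.
Proof. by rewrite -emb0 => /emb_inj. Qed.

Lemma emb_ad a b : emb (ad a b) = ad (emb a) (emb b).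
Proof. by rewrite embB /ad !pureM !mulr1. Qed.

Lemma emb_centre z : centre z -> centre (emb z).
Proof.
move=> zz u; rewrite [u]tensor_sum_pure mulr_sumr mulr_suml.
by apply: eq_bigr => p _; rewrite !pureM mul1r mulr1 zz.
Qed.

Lemma emb_operator_poly (p : {poly K}) a b :
  emb (operator_poly (ad a) p b) =
  operator_poly (ad (emb a)) (map_poly iota p) (emb b).
Proof.
rewrite /operator_poly size_map_poly (big_morph _ (pureDr _ 1) emb0).
apply: eq_bigr => i _; rewrite pure1Z coef_map; congr (_ *: _).
by elim: (nat_of_ord i) => //= j <-; rewrite emb_ad.
Qed.

(** The iterates of [ad a] on an element of a finite-dimensional orbit are
    dependent; conversely, division by a polynomial that kills [b] leaves
    finitely many iterates to span the orbit. *)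
Lemma ad_finiteP a b : ad_finite a b <->
  exists2 q : {poly K}, q != 0 & operator_poly (ad a) q b = 0.
Proof.
split=> [[n [t [_ St]]]|[q q0 qb]].
  have [c [c0 [i ci]]] : exists c : 'I_n.+1 -> K,
      lin_comb (fun i : 'I_n.+1 => iter i (ad a) b) c = 0 /\ exists i, c i != 0.
    apply: contrapT => nc.
    have : (n.+1 <= n)%N; last by rewrite ltnn.
    apply: (@free_family_le _ _ _ (fun i => iter i (ad a) b) _ t) => [c c0 i|i].
      apply/eqP/negPn/negP => ci; apply: nc; exists c; split=> //; by exists i.
    rewrite -St; exists 'X^i => //; rewrite -[LHS]/(operator_poly _ _ _).
    rewrite (@operator_poly_widen _ _ _ i.+1) ?size_polyXn // big_ord_recr /=.
    rewrite coefXn eqxx scale1r big1 ?add0r // => j _.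
    by rewrite coefXn ltn_eqF ?scale0r.
  pose q := \poly_(i < n.+1) (if insub i is Some j then c j else 0).
  have qE (j : 'I_n.+1) : q`_j = c j by rewrite coef_poly ltn_ord valK.
  exists q; first by apply: contraNneq ci => q0; rewrite -qE q0 coef0.
  rewrite (@operator_poly_widen _ _ _ n.+1) ?size_poly // -[RHS]c0.
  by apply: eq_bigr => j _; rewrite qE.
pose s := mkseq (fun i => iter i (ad a) b) (size q).
apply: (@subspace_finite_dim _ _ _ s); first exact: operator_poly_subspace.
move=> _ [p _ <-]; rewrite -[\sum_(_ < _) _]/(operator_poly (ad a) p b).
have -> : operator_poly (ad a) p b = operator_poly (ad a) (p %% q) b.
  rewrite {1}(divp_eq p q) operator_polyD operator_polyM; [|exact: adD|exact: adZ].
  by rewrite qb operator_poly0v ?add0r //; exact: adZ.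
apply: subspace_sum => [|i _]; first exact: lin_span_subspace.
apply: subspaceZ; first exact: lin_span_subspace.
apply: lin_span_gen; apply/mapP; exists (nat_of_ord i) => //.
by rewrite mem_iota /= add0n (ltn_trans (ltn_ord i)) // ltn_modp.
Qed.

End Descent.

(** * The Dixmier partition *)

Section Dixmier.
Variables (R : realType) (K : fieldType) (Kbar : closedFieldType).
Variables (iota : {rmorphism K -> Kbar}) (G : unitAlgType Kbar) (A : algType K).
Variable phi : {lrmorphism tensor iota A -> G}.
Hypothesis K0 : [pchar K] =i pred0.
Hypothesis Kbar_alg : is_algebraic_closure iota.
Hypothesis divG : division_ring G.
Hypothesis ccG : commutative_centralizer_condition G.
Hypothesis ncA : noncommutative A.
Hypothesis GKdim_lt3 : (GKdim R A < 3%:E)%E.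
Hypothesis phi_inj : injective phi.
Local Notation T := (tensor iota A).
Local Notation emb := (pure iota (1 : Kbar) : A -> T).
Local Notation N := (@ad_nilpotent K A).
Local Notation D := (@ad_diagonal K Kbar iota A).
Local Notation F := (@ad_finite K A).
Local Notation C := (@centralizer A).
Local Notation Delta := (@Delta K Kbar iota A).
Implicit Types (a b z : A) (u v x y : T) (lam mu : Kbar).

Let Kbar0 : [pchar Kbar] =i pred0.
Proof.
by apply/pcharf0P => n; rewrite -(rmorph_nat iota) fmorph_eq0 ((pcharf0P K).1 K0).
Qed.

Let phi0 : phi 0 = 0.
Proof. exact: rmorph0. Qed.

Let phi_eq0 u : phi u = 0 -> u = 0.
Proof. by rewrite -phi0 => /phi_inj. Qed.

Let phi_neq0 u : u != 0 -> phi u != 0.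
Proof. by apply: contraNneq => /phi_eq0 ->. Qed.

Let phi_ad u v : phi (ad u v) = ad (phi u) (phi v).
Proof. by rewrite /ad rmorphB !rmorphM. Qed.

Let emb_noncentral a : ~ centre a -> ~ centre (phi (emb a)).
Proof.
move=> na za; apply: na => b; apply/ad_eq0/(@emb_eq0 _ _ iota)/phi_eq0.
by rewrite emb_ad phi_ad; apply/ad_eq0/za.
Qed.

Lemma commutative_centralizer_descent : commutative_centralizer_condition A.
Proof.
split=> // a na b c ab ac.
apply/ad_eq0/(@emb_eq0 _ _ iota)/phi_eq0; rewrite emb_ad phi_ad; apply/ad_eq0.
have embC b' : centralizer a b' -> GRing.comm (phi (emb a)) (phi (emb b')).
  by move=> ab'; apply/ad_eq0; rewrite -phi_ad -emb_ad ab' emb0 rmorph0.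
by apply: comm_trans ccG (emb_noncentral na) _ _; apply: embC.
Qed.

Let cubic_growth_absurd u v y : ~ centre (phi u) ->
  ~ monomials_left_free (phi u) (phi v) (phi y).
Proof.
move=> nu /(monomials_free divG nu) free.
suff : (3%:E <= GKdim R A)%E by rewrite leNgt GKdim_lt3.
apply: (@GKdim_ge3 _ _ iota _ _ u v y) => n c c0; apply: free.
rewrite -[RHS]phi0 -[in RHS]c0 linear_sum.
by apply: eq_bigr => i _; rewrite linearZ /= !rmorphM !rmorphXn.
Qed.

Let no_jordan u v y lam : lam != 0 ->
  ad u y = lam *: y -> ad u v = lam *: v + y -> y = 0.
Proof.
move=> lam0 uy uv; apply/eqP/negPn/negP => y0.
have phi_uy : ad (phi u) (phi y) = lam *: phi y by rewrite -phi_ad uy linearZ.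
have phi_uv : ad (phi u) (phi v) = lam *: phi v + phi y.
  by rewrite -phi_ad uv linearD linearZ.
apply: (cubic_growth_absurd (eigenvector_noncentral phi_uy lam0 (phi_neq0 y0))).
exact (jordan_left_free divG ccG Kbar0 phi_uy phi_uv (phi_neq0 y0) lam0).
Qed.

(** A nilpotent and a semisimple direction at once would give a Jordan block of
    nonzero eigenvalue: multiply the former by the latter. *)
Let no_mixed x u y lam : lam != 0 -> u != 0 ->
  ad x u = lam *: u -> ad x (ad x y) = 0 -> ad x y = 0.
Proof.
move=> lam0 u0 xu xxy; have : ad x y * u = 0.
  apply: (@no_jordan x (y * u) _ lam) => //.
    by rewrite adM xxy mul0r add0r xu -scalerAr.
  by rewrite adM xu -scalerAr addrC.
move=> /(congr1 phi); rewrite rmorphM rmorph0.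
by case/(division_mulf_eq0 divG) => /phi_eq0 // u00; rewrite u00 eqxx in u0.
Qed.

Let semisimple_direction a := exists u lam,
  [/\ u != 0, lam != 0 & ad (emb a) u = lam *: u].

Let sub_CD a : (C a `<=` D a)%classic.
Proof.
move=> b ab; exists [:: (0, emb b)]; last by rewrite big_seq1.
by move=> p; rewrite inE => /eqP ->; rewrite scale0r -emb_ad ab emb0.
Qed.

Let sub_CN a : (C a `<=` N a)%classic.
Proof. by move=> b ab; exists 0%N. Qed.

Let semisimple_direction_of a : D a <> C a -> semisimple_direction a.
Proof.
move=> DC; apply: contrapT => ns; apply: DC.
apply/seteqP; split=> [b [s seig bE]|]; last exact: sub_CD.
apply/(@emb_eq0 _ _ iota); rewrite emb_ad bE.
rewrite (big_morph _ (adD (emb a)) (ad0 _)) big_seq_cond big1 // => p /andP[ps _].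
rewrite seig //; have [->|p10] := eqVneq p.1 0; first by rewrite scale0r.
have [->|p20] := eqVneq p.2 0; first by rewrite scaler0.
by case: ns; exists p.2, p.1; rewrite seig.
Qed.

Let nilpotent_direction_of a : C a <> N a ->
  exists2 b, ad a b != 0 & ad a (ad a b) = 0.
Proof.
move=> CN; apply: contrapT => nb; apply: CN.
apply/seteqP; split=> [|b [i _]]; first exact: sub_CN.
elim: i => [//|i IH]; rewrite /= => bi; apply: IH.
by apply/eqP/negPn/negP => nbi; apply: nb; exists (iter i (ad a) b).
Qed.

Let diagonal_eq_centralizer a : C a <> N a -> D a = C a.
Proof.
move=> /nilpotent_direction_of[b ab aab]; apply: contrapT.
move=> /semisimple_direction_of[u [lam [u0 lam0 au]]].
have := @no_mixed _ _ (emb b) _ lam0 u0 au; rewrite -!emb_ad aab emb0.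
by move=> /(_ erefl)/emb_eq0 ab0; rewrite ab0 eqxx in ab.
Qed.

(** The eigenvalues are algebraic over [K], which gives a polynomial over [K]
    that kills a given sum of eigenvectors. Conversely the polynomials over [K]
    split over the closure, where [ad a] has no Jordan block: not for a nonzero
    eigenvalue, and not for the eigenvalue zero either since a nonzero one
    occurs. *)
Let diagonal_eq_finite a : D a <> C a -> D a = F a.
Proof.
move=> /semisimple_direction_of[u [lam [u0 lam0 au]]]; apply/seteqP; split=> b.
  case=> s seig bE; apply/ad_finiteP.
  have /choice[q qP] mu : exists q : {poly K}, q != 0 /\ root (map_poly iota q) mu.
    by have [q q0 qmu] := Kbar_alg mu; exists q.
  exists (\prod_(p <- s) q p.1).
    by rewrite prodf_seq_neq0; apply/allP => p _ /=; have [] := qP p.1.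
  apply: (@emb_eq0 _ _ iota); rewrite emb_operator_poly bE.
  rewrite (big_morph _ (operator_poly_addv (adD _) _)
    (operator_poly0v (adZ _) _)) big_seq_cond big1 // => p /andP[ps _].
  rewrite (operator_poly_eigen (adZ (emb a)) _ (seig p ps)) rmorph_prod /=.
  rewrite (big_rem p) //= hornerM; have [_ /rootP ->] := qP p.1.
  by rewrite mul0r scale0r.
move=> /ad_finiteP[q q0 qb].
have {}qb : operator_poly (ad (emb a)) (map_poly iota q) (emb b) = 0.
  by rewrite -emb_operator_poly qb emb0.
have [rs qE] := closed_field_poly_normal (map_poly iota q).
apply: (@sum_of_eigenvectors _ _ (ad (emb a)) (adD _) (adZ _) rs).
  move=> mu v; set w := ad _ _ - _ => aw; apply/eqP; rewrite -subr_eq0 -/w; apply/eqP.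
  have [mu0|mu0] := eqVneq mu 0.
    have wE : w = ad (emb a) v by rewrite /w mu0 scale0r subr0.
    rewrite wE; apply: no_mixed lam0 u0 au _.
    by rewrite -wE aw mu0 scale0r.
  by apply: (@no_jordan _ v _ _ mu0 aw); rewrite /w [RHS]addrC subrK.
move: qb; rewrite qE operator_polyZ => /eqP; rewrite scaler_eq0 lead_coef_eq0.
by rewrite map_poly_eq0 (negbTE q0) /= => /eqP.
Qed.

Lemma dixmier_partition_holds : dixmier_partition iota A.
Proof.
apply/seteqP; split=> a; last by case=> t _ [].
move=> na; have [CN|CN] := EM (C a = N a); last first.
  have DC := diagonal_eq_centralizer CN; have [NT|NT] := EM (N a = setT).
    by exists StronglyNilpotent.
  by exists WeaklyNilpotent.
have [DC|DC] := EM (D a = C a); first by exists Generic => //; split=> //; rewrite DC.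
have [DT|DT] := EM (D a = setT); first by exists StronglySemisimple.
exists WeaklySemisimple => //; split=> //; split=> //; last by rewrite -diagonal_eq_finite.
- by move=> CD; apply: DC.
- exact: diagonal_eq_finite.
Qed.

Let centralizer_eq a b : ~ centre a -> ~ centre b -> C a b -> C b = C a.
Proof.
have [_ cc] := commutative_centralizer_descent => na nb ab.
have ba : C b a by apply/ad_eq0/commr_sym/ad_eq0.
by apply/seteqP; split=> c cc'; apply/ad_eq0; [apply: (cc b)|apply: (cc a)].
Qed.

(** [ad a] and [ad b] commute and have the same kernel, so [ad b] lowers the
    order of nilpotency for [ad a]. *)
Lemma ad_nilpotent_sub a b : C a b -> C b = C a -> (N a `<=` N b)%classic.
Proof.
move=> ab Cba x [i _]; rewrite /= => ax; exists i => //.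
have abC (y : A) : ad a (ad b y) = ad b (ad a y).
  by rewrite [ad b y]/ad adB !adM ab mul0r mulr0 add0r addr0.
have iter_abC j (y : A) : iter j (ad a) (ad b y) = ad b (iter j (ad a) y).
  by elim: j => //= j ->.
elim: i x ax => [|i IH] x ax.
  by have : C a x by []; rewrite -Cba.
change (iter i.+2 (ad b) x = 0); rewrite iterSr; apply: IH.
rewrite iter_abC abC; have : C a (iter i.+1 (ad a) x) by [].
by rewrite -Cba.
Qed.

Let ad_nilpotent_eq a b : ~ centre a -> ~ centre b -> C a b -> N b = N a.
Proof.
move=> na nb ab; have Cba := centralizer_eq na nb ab.
have ba : C b a by apply/ad_eq0/commr_sym/ad_eq0.
by apply/seteqP; split; apply: ad_nilpotent_sub.
Qed.

Let ad_diagonal_affine_sub a (c : K) z :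
  centre z -> (D a `<=` D (c *: a + z))%classic.
Proof.
move=> zz b [s seig bE].
exists [seq (iota c * p.1, p.2) | p <- s]; last by rewrite big_map.
move=> _ /mapP[p ps ->] /=; rewrite pureDr pure1Z.
by rewrite ad_affine ?seig ?scalerA //; apply: emb_centre.
Qed.

Let centre_affine a (c : K) z : c != 0 -> centre z -> centre (c *: a + z) -> centre a.
Proof.
move=> c0 zz caz b; apply/ad_eq0.
have : ad (c *: a + z) b = 0 by apply/ad_eq0/caz.
by rewrite ad_affine // => /eqP; rewrite scaler_eq0 (negbTE c0) => /eqP.
Qed.

Let punctured_line_commutes a b : ~ centre a -> punctured_line a b ->
  [/\ ~ centre b, C a b & D b = D a].
Proof.
move=> na [c [z [c0 zz ->]]]; split; first by move/(centre_affine c0 zz).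
  apply/ad_eq0/commrD; last exact: comm_centre.
  by rewrite /GRing.comm -scalerAr scalerAl.
apply/seteqP; split; last exact: ad_diagonal_affine_sub.
have aE : a = c^-1 *: (c *: a + z) + - c^-1 *: z.
  by rewrite scalerDr scalerA mulVf // scale1r scaleNr addrK.
rewrite {2}aE; apply: ad_diagonal_affine_sub => y.
by rewrite -scalerAl -scalerAr zz.
Qed.

(** A second semisimple element of a centralizer is, by rigidity, an affine
    function of the first over the closure; a retraction of the closure onto
    [K] makes the coefficient rational. *)
Let semisimple_rigid a b : ~ centre b -> C a b ->
  D a <> C a -> D b <> C b -> punctured_line a b.
Proof.
move=> nb ab /semisimple_direction_of[u [lam [u0 lam0 au]]].
move=> /semisimple_direction_of[v [mu [v0 mu0 bv]]].
have phi_ab : GRing.comm (phi (emb a)) (phi (emb b)).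
  by apply/ad_eq0; rewrite -phi_ad -emb_ad ab emb0 phi0.
have phi_au : ad (phi (emb a)) (phi u) = lam *: phi u by rewrite -phi_ad au linearZ.
have phi_bv : ad (phi (emb b)) (phi v) = mu *: phi v by rewrite -phi_ad bv linearZ.
have [|[kap kapP]] := rigid_or_left_free divG ccG Kbar0 phi_ab phi_au phi_bv
  (phi_neq0 u0) (phi_neq0 v0) lam0 mu0.
  move/cubic_growth_absurd; case.
  exact: eigenvector_noncentral phi_au lam0 (phi_neq0 u0).
have [r [f [_ fZ r1]]] := tensor_retraction iota A.
have bE (x : A) : ad b x = r kap *: ad a x.
  rewrite -fZ -[LHS]scale1r -r1 -fZ scale1r; congr f; apply: phi_inj.
  rewrite linearZ /= !emb_ad !phi_ad; apply/eqP; rewrite -subr_eq0 -adBl.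
  by apply/eqP/ad_eq0/kapP.
have zz : centre (b - r kap *: a).
  by move=> x; apply/ad_eq0; rewrite adBl bE subrr.
exists (r kap), (b - r kap *: a); split=> //; last by rewrite addrC subrK.
apply/eqP => r0; apply: nb => x; apply/ad_eq0.
by rewrite bE r0 scale0r.
Qed.

(** The type of the sets is written out, since the carrier of [A] as a ring and as
    an algebra are syntactically different and [congruence] is used below. *)
Let centralizer_neqT a : ~ centre a -> ~ @eq (set A) (C a) setT.
Proof. by move=> na CA; apply: na => b; apply/ad_eq0; rewrite -[_ = 0]/(C a b) CA. Qed.

Let Delta_disjoint t t' a : Delta t a -> Delta t' a -> t = t'.
Proof.
case=> /centralizer_neqT CT at_ [_ at'].
by case: t at_ => /= -[]; case: t' at' => /= -[]; intros; congruence.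
Qed.

Let semisimple_Delta t a : Delta t a ->
  t = StronglySemisimple \/ t = WeaklySemisimple ->
  [/\ ~ centre a, N a = C a & D a <> C a].
Proof.
case=> na at_ ht; split=> //; case: ht at_ => -> [] // NC.
by move=> DT; rewrite DT => /esym/(centralizer_neqT na).
by move=> CD _ _ /esym.
Qed.

Let punctured_line_Delta t a : Delta t a ->
  t = StronglySemisimple \/ t = WeaklySemisimple ->
  (punctured_line a `<=` Delta t)%classic.
Proof.
move=> at_ ht b ab; have [na NC DC] := semisimple_Delta at_ ht.
have [nb Cab Db] := punctured_line_commutes na ab.
have Nb := ad_nilpotent_eq na nb Cab; have Cb := centralizer_eq na nb Cab.
have DbC : D b <> C b by rewrite Db Cb.
split=> //; case: ht at_ => -> [_] /= [].
  by rewrite Nb Cb Db.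
move=> _ CD DF FT; rewrite -(diagonal_eq_finite DbC) Nb Cb Db; split=> //.
by rewrite DF.
Qed.

Let homogeneous_kind_witness a t : ~ centre a -> homogeneous_kind iota a t ->
  exists2 b, C a b /\ ~ centre b & Delta t b.
Proof.
move=> na; have Ca : C a a by rewrite /centralizer /= /ad subrr.
case: t => /= [aC|aC|[b bt [bC _ _]]|[b bt [bC _ _]]|aC].
1,2,5: by exists a => //; apply: aC.
all: have [Cb nb] : (C a `\` @centre A)%classic b; last by exists b.
all: by apply: bC; exists 1, 0; split; rewrite ?oner_neq0 ?scale1r ?addr0 // => x;
  rewrite mul0r mulr0.
Qed.

Let homogeneous_kind_members a b t : homogeneous_kind iota a t ->
  C a b -> ~ centre b ->
  Delta t b \/ (t = StronglySemisimple \/ t = WeaklySemisimple) /\ Delta Generic b.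
Proof.
case: t => /= [aC|aC|[a' _ [_ aD aG]]|[a' _ [_ aD aG]]|aC] Cab nb.
1,2,5: by left; apply: aC.
all: by have [/aD|nab] := EM (punctured_line a' b); [left|right; split;
  [by [left|right]|exact: aG]].
Qed.

(** Each kind is realized by an element of its own type, and only its own type
    and the generic one occur in it. *)
Let homogeneous_kind_unique a t t' : ~ centre a ->
  homogeneous_kind iota a t -> homogeneous_kind iota a t' -> t = t'.
Proof.
move=> na ht ht'.
have [b [Cb nb] bt] := homogeneous_kind_witness na ht.
have [c [Cc nc] ct'] := homogeneous_kind_witness na ht'.
have [/(Delta_disjoint bt)//|[ss' /(Delta_disjoint bt) tG]] :=
  homogeneous_kind_members ht' Cb nb.
have [/(Delta_disjoint ct')//|[ss _]] := homogeneous_kind_members ht Cc nc.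
by case: ss; rewrite tG.
Qed.

Let homogeneous_kind_exists a : ~ centre a -> exists t, homogeneous_kind iota a t.
Proof.
move=> na.
have CE b : C a b -> ~ centre b -> C b = C a /\ N b = N a.
  by move=> ab nb; split; [apply: centralizer_eq|apply: ad_nilpotent_eq].
have [CN|CN] := EM (C a = N a); last first.
  have [NT|NT] := EM (N a = setT);
    [exists StronglyNilpotent|exists WeaklyNilpotent] => /= b [ab nb];
    have [Cb Nb] := CE b ab nb; split=> //=;
    have DC : D b = C b by [apply: diagonal_eq_centralizer; rewrite Cb Nb].
    by rewrite DC Nb.
  by rewrite DC Nb Cb.
have [[a' [aa' na' DC']]|generic] :=
  EM (exists a', [/\ C a a', ~ centre a' & D a' <> C a']); last first.
  exists Generic => /= b [ab nb]; have [Cb Nb] := CE b ab nb; split=> //=.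
  have DC : D b = C b by apply: contrapT => DC; apply: generic; exists b.
  by rewrite DC Nb Cb.
have [t ss a't] : exists2 t, t = StronglySemisimple \/ t = WeaklySemisimple &
    Delta t a'.
  have : (~` @centre A)%classic a' by [].
  rewrite dixmier_partition_holds => -[t _ a't]; exists t => //.
  have [Ca' Na'] := CE a' aa' na'; case: a't => _.
  by case: t => /= -[]; intros; [congruence|congruence|by left|by right|congruence].
have kind : exists2 a' : A, Delta t a' &
   [/\ (punctured_line a' `<=` C a `\` @centre A)%classic,
      (punctured_line a' `<=` Delta t)%classic &
      ((C a `\` @centre A) `\` punctured_line a' `<=` Delta Generic)%classic].
  exists a' => //.
  split=> [b /(punctured_line_commutes na')[nb a'b _]||b [[ab nb] nline]].
  - by split=> //; have [<- _] := CE a' aa' na'.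
  - exact: punctured_line_Delta.
  have [Cb Nb] := CE b ab nb.
  have DC : D b = C b.
    apply: contrapT => DC; apply: nline; apply: semisimple_rigid => //.
    by have [-> _] := CE a' aa' na'.
  by split=> //=; rewrite DC Nb Cb.
by exists t; case: ss kind => ->.
Qed.

Lemma homogeneous_centralizers : homogeneous_centralizer_condition iota A.
Proof.
split=> //; first exact: dixmier_partition_holds.
move=> a na; have [t ht] := homogeneous_kind_exists na.
by exists t; split=> // t'; apply: homogeneous_kind_unique.
Qed.

End Dixmier.

Theorem theorem1p3 (R : realType) (K : fieldType) (Kbar : closedFieldType)
    (iota : {rmorphism K -> Kbar})
    (Gamma : unitAlgType Kbar) (A : algType K)
    (phi : {lrmorphism tensor iota A -> Gamma}) :
  [pchar K] =i pred0 ->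
  is_algebraic_closure iota ->
  division_ring Gamma ->
  commutative_centralizer_condition Gamma ->
  noncommutative A ->
  (GKdim R A < 3%:E)%E ->
  injective phi ->
  [/\ dixmier_partition iota A,
      homogeneous_centralizer_condition iota A &
      commutative_centralizer_condition A].
Proof.
move=> K0 Kbar_alg divG ccG ncA GK phi_inj; split.
- exact: dixmier_partition_holds K0 Kbar_alg divG ccG GK phi_inj.
- exact: homogeneous_centralizers K0 Kbar_alg divG ccG ncA GK phi_inj.
- exact: commutative_centralizer_descent ccG ncA phi_inj.
Qed.
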